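(* The set of all analytic statistical structures $(g,\nabla)$ around $0\in\mathbb{R}^n$, where $n>2$ and $g_{ij}(0)=\delta_{ij}$, depends on $\frac{n^3+6n^2+5n}{6}$ arbitrarily chosen analytic functions of $n$ variables, from which one function is $g_{11}$ and $\frac{n^3+6n^2+5n-6}{6}$ functions are some Christoffel symbols of $\nabla$, and on $\frac{n(n+1)}{2}-1$ arbitrarily chosen analytic functions $g_{ij}$, for $(i,j)\neq(1,1)$, of $n-1$ variables.
   Context: Objects in a neighborhood of $0$ are understood as their germs at $0$. A statistical structure is a pair $(g,\nabla)$, where $g$ is a positive definite metric tensor field and $\nabla$ is a torsion-free linear connection such that $\nabla g$, as a $(0,3)$-tensor field (cubic form), is totally symmetric. In an analytic coordinate system $(x^1,\dots,x^n)$, $g_{ij}=g(\partial_i,\partial_j)$ and the Christoffel symbols $\Gamma^k_{ij}$ of $\nabla$ are given by $\nabla_{\partial_i}\partial_j=\sum_k\Gamma^k_{ij}\partial_k$. The arbitrary choice of the functions $g_{ij}$ is modulo the normalization $g_{ij}(0)=\delta_{ij}$. *)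

(* Defs.v *)
From HB Require Import structures.
From mathcomp Require Import all_boot all_order all_algebra.
From mathcomp Require Import all_classical all_reals all_analysis.

Set Implicit Arguments.
Unset Strict Implicit.
Unset Printing Implicit Defensive.

Import Order.TTheory GRing.Theory Num.Theory.
Import numFieldNormedType.Exports.
Local Open Scope classical_set_scope.
Local Open Scope ring_scope.

(* Coordinates are numbered from 0, so that x^1 is the coordinate [ord0] and
   g_11 is [g ord0 ord0].  A germ at 0 is represented by a total function, and
   germs are compared by [eq_germ]; the values of a representative away from 0
   are irrelevant. *)

Section RealAnalytic.
Variables (R : realType) (n : nat).
Implicit Types (f : 'rV[R]_n -> R) (p y : 'rV[R]_n).

(* The term a_alpha y^alpha of a power series in n variables. *)
Definition pseries_term (a : {ffun 'I_n -> nat} -> R) y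
    (alpha : {ffun 'I_n -> nat}) : R :=
  a alpha * \prod_(i < n) y 0 i ^+ alpha i.

(* The sum of the terms all of whose exponents are smaller than N. *)
Definition pseries_box (a : {ffun 'I_n -> nat} -> R) y (N : nat) : R :=
  \sum_(alpha : {ffun 'I_n -> 'I_N})
    pseries_term a y [ffun i => nat_of_ord (alpha i)].

(* Absolute convergence makes the sum independent of the order of summation,
   so the boxes may be used to compute it. *)
Definition analytic_at f p : Prop :=
  exists a : {ffun 'I_n -> nat} -> R,
    \forall y \near (0 : 'rV[R]_n),
      summable [set: {ffun 'I_n -> nat}]
               (fun alpha => (pseries_term a y alpha)%:E)
      /\ pseries_box a y N @[N --> \oo] --> f (p + y).

Definition analytic_around0 f : Prop :=
  \forall p \near (0 : 'rV[R]_n), analytic_at f p.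

Definition eq_germ f1 f2 : Prop :=
  \forall x \near (0 : 'rV[R]_n), f1 x = f2 x.

End RealAnalytic.

Section StatisticalStructure.
Variables (R : realType) (n : nat).

(* [g i j] is g(d_i, d_j). *)
Definition metric_coefs := 'I_n -> 'I_n -> 'rV[R]_n -> R.

(* [G k i j] is Gamma^k_{ij}, where nabla_{d_i} d_j = sum_k Gamma^k_{ij} d_k. *)
Definition christoffel_symbols := 'I_n -> 'I_n -> 'I_n -> 'rV[R]_n -> R.

Implicit Types (g : metric_coefs) (G : christoffel_symbols).

Definition partial (k : 'I_n) (f : 'rV[R]_n -> R) (x : 'rV[R]_n) : R :=
  'D_(delta_mx 0 k) f x.

Definition pos_def_metric_at g (x : 'rV[R]_n) : Prop :=
  (forall i j, g i j x = g j i x) /\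
  (forall v : 'rV[R]_n, v != 0 ->
     0 < \sum_(i < n) \sum_(j < n) g i j x * v 0 i * v 0 j).

(* The d_k-component of nabla_{d_i} d_j - nabla_{d_j} d_i - [d_i, d_j]. *)
Definition torsion G (k i j : 'I_n) (x : 'rV[R]_n) : R := G k i j x - G k j i x.

(* (nabla_{d_k} g)(d_i, d_j)
     = d_k (g(d_i, d_j)) - g(nabla_{d_k} d_i, d_j) - g(d_i, nabla_{d_k} d_j) *)
Definition cubic_form g G (k i j : 'I_n) (x : 'rV[R]_n) : R :=
  partial k (g i j) x - \sum_(l < n) G l k i x * g l j x
                      - \sum_(l < n) G l k j x * g i l x.

(* Invariance under two transpositions that generate the permutations of the
   three arguments. *)
Definition totally_symmetric (T : 'I_n -> 'I_n -> 'I_n -> R) : Prop :=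
  forall a b c, T b a c = T a b c /\ T a c b = T a b c.

Record analytic_statistical_structure g G : Prop := {
  metric_analytic : forall i j, analytic_around0 (g i j);
  connection_analytic : forall k i j, analytic_around0 (G k i j);
  metric_pos_def : \forall x \near (0 : 'rV[R]_n), pos_def_metric_at g x;
  torsion_free :
    \forall x \near (0 : 'rV[R]_n), forall k i j, torsion G k i j x = 0;
  codazzi :
    \forall x \near (0 : 'rV[R]_n),
      totally_symmetric (fun k i j => cubic_form g G k i j x)
}.

Definition normalized g : Prop := forall i j, g i j 0 = (i == j)%:R.

Definition eq_structure_germ g G g' G' : Prop :=
  (forall i j, eq_germ (g i j) (g' i j)) /\
  (forall k i j, eq_germ (G k i j) (G' k i j)).

End StatisticalStructure.

Section Parametrization.
Variables (R : realType) (m : nat).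
Local Notation n := m.+1.

(* The embedding (x^2, ..., x^n) |-> (0, x^2, ..., x^n) of R^(n-1) in R^n. *)
Definition hyperplane (y : 'rV[R]_m) : 'rV[R]_n := row_mx (0 : 'rV[R]_1) y.

(* The triple (k, i, j), with i <= j, stands for Gamma^k_{ij} = Gamma^k_{ji}. *)
Definition christoffel_indices : {set 'I_n * 'I_n * 'I_n} :=
  [set t : 'I_n * 'I_n * 'I_n | (t.1.2 <= t.2)%N].

(* The pair (i, j), with i <= j and (i, j) different from the first pair,
   stands for g_ij = g_ji. *)
Definition metric_indices : {set 'I_n * 'I_n} :=
  [set t : 'I_n * 'I_n | (t.1 <= t.2)%N && (t != (ord0, ord0))].

(* The parameters are [f], to be g_11; [gam t] for t in S, to be the Christoffel
   symbols indexed by S; and [h t] for t in metric_indices, to be the functions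
   g_ij on the hyperplane x^1 = 0.  The other values of [gam] and [h] are not
   constrained and not used. *)
Definition admissible_parameters (S : {set 'I_n * 'I_n * 'I_n})
    (f : 'rV[R]_n -> R) (gam : 'I_n * 'I_n * 'I_n -> 'rV[R]_n -> R)
    (h : 'I_n * 'I_n -> 'rV[R]_m -> R) : Prop :=
  [/\ analytic_around0 f /\ f 0 = 1,
      forall t, t \in S -> analytic_around0 (gam t) &
      forall t, t \in metric_indices ->
        analytic_around0 (h t) /\ h t 0 = (t.1 == t.2)%:R].

Definition has_parameters (S : {set 'I_n * 'I_n * 'I_n})
    (f : 'rV[R]_n -> R) (gam : 'I_n * 'I_n * 'I_n -> 'rV[R]_n -> R)
    (h : 'I_n * 'I_n -> 'rV[R]_m -> R)
    (g : metric_coefs R n) (G : christoffel_symbols R n) : Prop :=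
  [/\ eq_germ (g ord0 ord0) f,
      forall t, t \in S -> eq_germ (G t.1.1 t.1.2 t.2) (gam t) &
      forall t, t \in metric_indices ->
        eq_germ (fun y => g t.1 t.2 (hyperplane y)) (h t)].

End Parametrization.

(* Main.v *)
(* Write g = 1 + v.  The Codazzi equations E(k,i,j) = 0 compare
   d_k g_ij - d_i g_kj with g(d_i, nabla_k d_j) - g(d_k, nabla_i d_j); they are
   antisymmetric in k, i and have vanishing cyclic sums.  For i <= j, j > 1, the
   equation E(1,j,i) = 0 gives d_1 g_ij.  Those with k, i > 1 contain no
   derivative along x^1, and as g(0) is the identity they can be solved for the
   symbols Gamma^a_bc such that 1 < s < a, where s is the smallest of b, c other
   than 1.  All the others follow.  Hence the power series of v and Gamma are
   determined recursively by the parameters.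

   Convergence is proved as in the Cauchy-Kovalevskaya theorem.  With
   s = rho (lam x^1 + x^2 + ... + x^n), one keeps v below eps Phi(s) and Gamma
   below C Psi(s), where Phi = sum s^k / (k+1)^2 and Psi = sum s^k / (k+1).
   Indeed Phi Psi is below 4 Psi, a derivative along x^i, i > 1, maps Phi below
   rho Psi, and a primitive along x^1 maps Psi below 4 Phi / (lam rho); so
   choosing eps small, then rho large, then lam large makes the bounds
   self-consistent.  This needs the initial values of v to vanish at 0. *)
Require Import Defs.
From mathcomp Require Import all_boot all_order all_algebra.
From mathcomp Require Import all_classical all_reals all_analysis.
From mathcomp Require Import finmap ring lra zify.

Set Implicit Arguments.
Unset Strict Implicit.
Unset Printing Implicit Defensive.

Import Order.TTheory GRing.Theory Num.Theory.
Import numFieldNormedType.Exports.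
Local Open Scope classical_set_scope.
Local Open Scope ring_scope.

(** * Unordered sums *)

Section FsetFilter.
Variable I : choiceType.
Local Open Scope fset_scope.

(** Nothing prescribes the derivative of Gamma along x^1: Gamma is determined by algebraic equations
    that contain derivatives of v. It is not eliminated by inverting a matrix depending on v.
    Instead, the pair (v, Gamma) is a fixed point of a map on formal series in which only the
    identity part of g is inverted, while the product v Gamma stays on the right-hand side; v(0) = 0
    makes that product lag behind Gamma. The iterates from zero become stationary coefficient by
    coefficient, and a bound preserved by the map passes to the limit with no convergence argument.
    Two majorants are needed because Gamma has the size of a derivative of v, which costs a factor k
    + 1. Psi need not be stable under products, since Gamma occurs linearly: the convolution of
    1/(k+1) with itself carries a logarithm, its convolution with 1/(k+1)^2 does not. *)

Definition fset_filter : set_system {fset I} :=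
  filter_from setT (fun A => [set B | A `<=` B]).

#[global] Instance fset_filter_proper : ProperFilter fset_filter.
Proof.
eapply filter_from_proper; last by move=> A _; exists A; rewrite /= fsubset_refl.
apply: filter_fromT_filter; first by exists fset0.
by move=> A B /=; exists (A `|` B) => P /=; rewrite fsubUset => /andP[].
Qed.

Lemma fset_filter_ge (A : {fset I}) :
  \forall B \near fset_filter, A `<=` B.
Proof. by exists A. Qed.

End FsetFilter.

Lemma cvg_seq_sum (R : realType) T (FF : set_system T) {FFF : Filter FF} (K : Type)
    (r : seq K) (f : K -> T -> R) (l : K -> R) :
  (forall k, f k x @[x --> FF] --> l k) ->
  (\sum_(k <- r) f k x) @[x --> FF] --> \sum_(k <- r) l k.
Proof.
move=> fl; elim: r => [|k r IH].
  by rewrite big_nil; under eq_fun do rewrite big_nil; exact: cvg_cst.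
by rewrite big_cons; under eq_fun do rewrite big_cons; apply: cvgD.
Qed.

Section HasSum.
Variable R : realType.
Implicit Types I J K : choiceType.

Definition fsum I (F : I -> R) (A : {fset I}) : R := \sum_(i <- A) F i.

(** Unconditional summation, as a limit over the finite subsets ordered by inclusion: no enumeration
    of the index type is involved, so reindexing and regrouping are direct. *)
Definition has_sum I (F : I -> R) (s : R) : Prop :=
  fsum F A @[A --> @fset_filter I] --> s.

Definition abs_bounded I (F : I -> R) : Prop :=
  exists C : R, forall A : {fset I}, fsum (fun i => `|F i|) A <= C.

Lemma has_sumP I (F : I -> R) s :
  (forall e, 0 < e -> exists A : {fset I}, forall B : {fset I},
     (A `<=` B)%fset -> `|s - fsum F B| <= e) <-> has_sum F s.
Proof.
split=> [H|/cvgrPdist_le H e e0].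
  apply/cvgrPdist_le => e e0; have [A HA] := H e e0.
  by exists A => // B /= AB; apply: HA.
by have [A _ HA] := H e e0; exists A => B AB; apply: HA.
Qed.

Lemma has_sum_unique I (F : I -> R) s t : has_sum F s -> has_sum F t -> s = t.
Proof. by move=> Fs Ft; apply: (cvg_unique _ Fs Ft). Qed.

Lemma eq_has_sum I (F G : I -> R) s : F =1 G -> has_sum F s -> has_sum G s.
Proof. by move=> /funext ->. Qed.

Lemma eq_abs_bounded I (F G : I -> R) : F =1 G -> abs_bounded F -> abs_bounded G.
Proof. by move=> /funext ->. Qed.

Lemma has_sumD I (F G : I -> R) s t :
  has_sum F s -> has_sum G t -> has_sum (fun i => F i + G i) (s + t).
Proof.
move=> Fs Gt; rewrite /has_sum.
have -> : fsum (fun i => F i + G i) = fsum F \+ fsum G.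
  by apply/funext => A; rewrite /fsum big_split.
exact: cvgD.
Qed.

Lemma has_sumZ I (F : I -> R) c s :
  has_sum F s -> has_sum (fun i => c * F i) (c * s).
Proof.
move=> Fs; rewrite /has_sum.
have -> : fsum (fun i => c * F i) = cst c \* fsum F.
  by apply/funext => A; rewrite /fsum -big_distrr.
by apply: cvgM => //; exact: cvg_cst.
Qed.

Lemma fsum_sub I (F : I -> R) (A B : {fset I}) : (A `<=` B)%fset ->
  (forall i, i \in B -> i \notin A -> F i = 0) -> fsum F B = fsum F A.
Proof.
by move=> AB F0; rewrite /fsum -(big_fset_incl _ AB).
Qed.

Lemma ler_fsum_sub I (F : I -> R) (A B : {fset I}) : (A `<=` B)%fset ->
  (forall i, 0 <= F i) -> fsum F A <= fsum F B.
Proof.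
move=> AB F0.
rewrite /fsum [X in _ <= X](big_fsetID _ (mem A)) /=.
have -> : [fset x in B | x \in A]%fset = A.
  apply/fsetP => x; rewrite !inE /=; case: (boolP (x \in A)); last by rewrite andbF.
  by move=> xA; rewrite (fsubsetP AB).
by rewrite lerDl sumr_ge0.
Qed.

Lemma has_sum_finite I (F : I -> R) (A : {fset I}) :
  (forall i, i \notin A -> F i = 0) -> has_sum F (fsum F A).
Proof.
move=> F0; apply/has_sumP => e e0; exists A => B AB.
by rewrite (fsum_sub AB) ?subrr ?normr0 ?ltW // => i _; apply: F0.
Qed.

Lemma abs_bounded_le I (F G : I -> R) :
  (forall i, `|F i| <= `|G i|) -> abs_bounded G -> abs_bounded F.
Proof.
move=> FG [C HC]; exists C => A; apply: le_trans (HC A).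
by apply: ler_sum => i _; exact: FG.
Qed.

Lemma abs_boundedD I (F G : I -> R) :
  abs_bounded F -> abs_bounded G -> abs_bounded (fun i => F i + G i).
Proof.
move=> [C HC] [D HD]; exists (C + D) => A.
apply: (le_trans _ (lerD (HC A) (HD A))).
by rewrite /fsum -big_split; apply: ler_sum => i _; exact: ler_normD.
Qed.

Lemma abs_boundedZ I (F : I -> R) c :
  abs_bounded F -> abs_bounded (fun i => c * F i).
Proof.
move=> [C HC]; exists (`|c| * C) => A.
rewrite /fsum (eq_bigr (fun i => `|c| * `|F i|)); last by move=> i _; rewrite normrM.
by rewrite -big_distrr; apply: ler_wpM2l => //; exact: HC.
Qed.

Lemma abs_bounded_single I (F : I -> R) : abs_bounded F ->
  exists2 C, 0 <= C & forall i, `|F i| <= C.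
Proof.
move=> [C HC]; have C0 : 0 <= C by have := HC fset0; rewrite /fsum big_seq_fset0.
by exists C => // i; have := HC [fset i]%fset; rewrite /fsum big_seq_fset1.
Qed.

Lemma has_sum_nonneg I (F : I -> R) : (forall i, 0 <= F i) -> abs_bounded F ->
  exists s, has_sum F s.
Proof.
move=> F0 [C HC].
have FC A : fsum F A <= C.
  by apply: le_trans (HC A); apply: ler_sum => i _; exact: ler_norm.
pose E := [set fsum F A | A in [set: {fset I}]].
have hE : has_sup E.
  split; first by exists (fsum F fset0), fset0.
  by exists C => _ [A _ <-].
exists (sup E); apply/has_sumP => e e0.
have [_ [A _ <-] HA] := sup_adherent e0 hE.
exists A => B AB.
have h1 : fsum F B <= sup E by apply: (ub_le_sup hE.2); exists B.
have h2 := ler_fsum_sub AB F0.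
rewrite ger0_norm ?subr_ge0 //; lra.
Qed.

Lemma abs_bounded_has_sum I (F : I -> R) : abs_bounded F -> exists s, has_sum F s.
Proof.
move=> bF.
have [s1 H1] : exists s, has_sum (fun i => `|F i|) s.
  apply: has_sum_nonneg => //; apply: abs_bounded_le bF => i; by rewrite normr_id.
have [s2 H2] : exists s, has_sum (fun i => F i + `|F i|) s.
  apply: has_sum_nonneg.
    by move=> i; have := ler_norm (- F i); rewrite normrN; lra.
  apply: abs_boundedD => //; apply: abs_bounded_le bF => i; by rewrite normr_id.
exists (s2 + -1 * s1); apply: (eq_has_sum _ (has_sumD H2 (has_sumZ (c := -1) H1))) => i /=.
by rewrite mulN1r addrK.
Qed.

Lemma has_sum_le_bound I (F : I -> R) s C :
  has_sum F s -> (forall A, fsum (fun i => `|F i|) A <= C) -> `|s| <= C.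
Proof.
move=> Fs HC; apply/ler_addgt0Pr => e e0.
have [A HA] := (has_sumP F s).2 Fs e e0.
have h1 := HA A (fsubset_refl A).
have h2 : `|fsum F A| <= C by apply: le_trans (HC A); exact: ler_norm_sum.
have := ler_normD (s - fsum F A) (fsum F A); rewrite subrK; lra.
Qed.


Lemma fsum_fiber I K (p : I -> K) (F : I -> R) (c : K -> R) (B : {fset K})
    (C : {fset I}) :
  \sum_(k <- B) c k * fsum (fun i => if p i == k then F i else 0) C =
  fsum (fun i => if p i \in B then c (p i) * F i else 0) C.
Proof.
rewrite /fsum; under eq_bigr do rewrite big_distrr /=.
rewrite exchange_big /=; apply: eq_bigr => i _.
case: ifPn => [pB|pB].
  rewrite (big_fsetD1 (p i)) //= eqxx big1_seq ?addr0 // => k /andP[_].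
  by rewrite !inE eq_sym => /andP[/negbTE -> _]; rewrite mulr0.
rewrite big1_seq // => k /andP[_ kB]; case: eqP => [E|_]; last by rewrite mulr0.
by rewrite E kB in pB.
Qed.

(* Summation by packets along the fibers of [p]; with [p] a projection of a
   product this is Fubini's theorem. *)
Lemma has_sum_fiber I K (p : I -> K) (F : I -> R) s (u : K -> R) :
  has_sum F s ->
  (forall k, has_sum (fun i => if p i == k then F i else 0) (u k)) ->
  has_sum u s.
Proof.
move=> Fs Hu; apply/has_sumP => e e0.
have [A HA] := (has_sumP F s).2 Fs e e0.
exists (p @` A)%fset => B AB.
(* Once C contains A, the part of C lying over B contains A as well, because B contains p(A). Its
   sum is then within e of s, and the bound passes to the limit in C. *)
have Hd : `|s - \sum_(k <- B) 1 * fsum (fun i => if p i == k then F i else 0) C|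
    @[C --> @fset_filter I] --> `|s - fsum u B|.
  apply: cvg_norm; apply: cvgB; first exact: cvg_cst.
  rewrite /fsum; apply: cvg_seq_sum => k.
  by under eq_fun do rewrite mul1r; apply: Hu.
apply: (cvgr_to_le Hd); near=> C.
rewrite fsum_fiber.
have CA : (A `<=` C)%fset by near: C; apply: fset_filter_ge.
pose C' := [fset i in C | p i \in B]%fset.
suff -> : fsum (fun i => if p i \in B then 1 * F i else 0) C = fsum F C'.
  apply: HA; apply/fsubsetP => i iA; rewrite !inE /= (fsubsetP CA) //=.
  by apply: (fsubsetP AB); apply: in_imfset.
have C'C : (C' `<=` C)%fset by apply/fsubsetP => i; rewrite !inE /= => /andP[].
rewrite (fsum_sub C'C); last by move=> i iC; rewrite !inE /= iC /= => /negbTE ->.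
apply: eq_big_seq => i; rewrite !inE /= => /andP[_ ->]; exact: mul1r.
Unshelve. all: by end_near. Qed.

(** Since [|u k|] is [u k] times its sign, a finite sum of the [|u k|] is a limit of signed finite
    sums of F, all below the absolute bound of F. *)
Lemma abs_bounded_fiber I K (p : I -> K) (F : I -> R) (u : K -> R) :
  abs_bounded F ->
  (forall k, has_sum (fun i => if p i == k then F i else 0) (u k)) ->
  abs_bounded u.
Proof.
move=> [M HM] Hu; exists M => B.
have Hd : \sum_(k <- B) Num.sg (u k) * fsum (fun i => if p i == k then F i else 0) C
    @[C --> @fset_filter I] --> fsum (fun k => `|u k|) B.
  rewrite /fsum; apply: cvg_seq_sum => k.
  rewrite normrEsg; apply: cvgM; first exact: cvg_cst.
  exact: Hu.
apply: (cvgr_to_le Hd); near=> C; rewrite fsum_fiber.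
apply: le_trans (HM C); apply: ler_sum => i _; case: ifP => // _.
apply: le_trans (ler_norm _) _; rewrite normrM normr_sg.
by case: (u _ == 0); rewrite ?mul0r ?mul1r.
Unshelve. all: by end_near. Qed.

Lemma fsum_imfset I J (h : J -> I) (F : I -> R) (A : {fset J}) :
  injective h -> fsum F (h @` A)%fset = fsum (F \o h) A.
Proof. by move=> hi; rewrite /fsum big_imfset //= => i j _ _ /hi. Qed.

Lemma has_sum_inj I J (h : J -> I) (F : I -> R) s : injective h ->
  (forall i, (forall j, h j <> i) -> F i = 0) ->
  has_sum (F \o h) s <-> has_sum F s.
Proof.
move=> hi F0.
(* B is the preimage of A under h, computed with a partial inverse [q]; the terms of A outside the
   range of h vanish. *)
have key (A : {fset I}) : exists B : {fset J},
    [/\ forall j, (h j \in A) -> j \in B & fsum F A = fsum (F \o h) B].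
  pose q (i : I) : option J :=
    if pselect (exists j, h j = i) is left H then Some (projT1 (cid H)) else None.
  have qh j : q (h j) = Some j.
    rewrite /q; case: pselect => [H|[]]; last by exists j.
    by case: (cid H) => j' /= /hi ->.
  have qE i j : q i = Some j -> h j = i.
    by rewrite /q; case: pselect => // H [<-]; case: (cid H).
  exists [fset j in pmap q A]%fset; split.
    by move=> j jA; rewrite !inE /= mem_pmap -qh; apply: map_f.
  rewrite -fsum_imfset //; apply: fsum_sub.
    apply/fsubsetP => i /imfsetP[j /=]; rewrite inE mem_pmap => /mapP[i' iA] /esym.
    by move=> /qE E ->; rewrite E.
  move=> i iA iN; apply: F0 => j E; move/negP: iN; apply; apply/imfsetP.
  by exists j => //=; rewrite inE mem_pmap -qh E; apply: map_f.
split=> /has_sumP H; apply/has_sumP => e e0; have [A HA] := H e e0.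
  exists (h @` A)%fset => B AB; have [C [BC ->]] := key B.
  apply: HA; apply/fsubsetP => j jA; apply: BC; apply: (fsubsetP AB).
  exact: in_imfset.
have [A' [AA' EA]] := key A.
exists A' => B AB; have := HA (A `|` h @` B)%fset (fsubsetUl _ _).
rewrite (@fsum_sub _ _ (h @` B)%fset); first by rewrite fsum_imfset.
  exact: fsubsetUr.
move=> i; rewrite inE => /orP[iA|-> //] iN; apply: F0 => j E.
move/negP: iN; apply; rewrite -E; apply: in_imfset => /=; apply: (fsubsetP AB).
by apply: AA'; rewrite E.
Qed.

Lemma abs_bounded_norm I (F : I -> R) : abs_bounded F -> abs_bounded (fun i => `|F i|).
Proof. by apply: abs_bounded_le => i; rewrite normr_id. Qed.

Lemma abs_bounded_inj I J (h : J -> I) (F : I -> R) : injective h ->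
  abs_bounded F -> abs_bounded (F \o h).
Proof.
move=> hi [C HC]; exists C => A.
by have := HC (h @` A)%fset; rewrite fsum_imfset.
Qed.

(** A finite set of pairs lies in the product of its two projections, over which the sum can be
    taken row by row. *)
Lemma abs_bounded_rows I J (F : I * J -> R) (u : I -> R) : abs_bounded u ->
  (forall i (A : {fset J}), fsum (fun j => `|F (i, j)|) A <= u i) ->
  abs_bounded F.
Proof.
move=> [C HC] Hu; exists C => A.
pose A1 := [fset x.1 | x in A]%fset; pose A2 := [fset x.2 | x in A]%fset.
have sub : (A `<=` A1 `*` A2)%fset.
  by apply/fsubsetP => -[i j] ijA; rewrite in_fsetM; apply/andP; split;
     apply/imfsetP; exists (i, j).
apply: (le_trans (ler_fsum_sub sub _)) => //.
rewrite /fsum (perm_big [seq (i, j) | i <- A1, j <- A2]); last first.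
  apply: uniq_perm; [exact: fset_uniq|apply: allpairs_uniq|].
  - exact: fset_uniq.
  - exact: fset_uniq.
  - by move=> [? ?] [? ?] _ _.
  move=> -[i j]; rewrite in_fsetM; apply/andP/allpairsP => [[iA jA]|].
    by exists (i, j).
  by move=> [[i' j'] /= [iA jA [-> ->]]].
rewrite big_allpairs /=; apply: le_trans (HC A1); apply: ler_sum => i _.
exact: le_trans (Hu i A2) (ler_norm _).
Qed.

Lemma abs_bounded_prod I J (F : I -> R) (G : J -> R) :
  abs_bounded F -> abs_bounded G -> abs_bounded (fun ij : I * J => F ij.1 * G ij.2).
Proof.
move=> bF [D HD]; apply: (@abs_bounded_rows _ _ _ (fun i => D * `|F i|)).
  by apply: abs_boundedZ; exact: abs_bounded_norm.
move=> i A; rewrite mulrC /fsum (eq_bigr (fun j => `|F i| * `|G j|)).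
  by rewrite -big_distrr; apply: ler_wpM2l => //; exact: HD.
by move=> j _; rewrite normrM.
Qed.

Lemma has_sum_row I J (F : I * J -> R) i s :
  has_sum (fun j => F (i, j)) s ->
  has_sum (fun ij => if ij.1 == i then F ij else 0) s.
Proof.
move=> H; apply/(@has_sum_inj _ _ (fun j => (i, j))).
- by move=> j j' [].
- by move=> [i' j] /= N; case: eqP => // E; case: (N j); rewrite E.
- by apply: (eq_has_sum _ H) => j /=; rewrite eqxx.
Qed.

Lemma has_sum_col I J (F : I * J -> R) j s :
  has_sum (fun i => F (i, j)) s ->
  has_sum (fun ij => if ij.2 == j then F ij else 0) s.
Proof.
move=> H; apply/(@has_sum_inj _ _ (fun i => (i, j))).
- by move=> i i' [].
- by move=> [i j'] /= N; case: eqP => // E; case: (N i); rewrite E.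
- by apply: (eq_has_sum _ H) => i /=; rewrite eqxx.
Qed.

Lemma has_sum_prod I J (F : I -> R) (G : J -> R) s t :
  abs_bounded F -> abs_bounded G -> has_sum F s -> has_sum G t ->
  has_sum (fun ij : I * J => F ij.1 * G ij.2) (s * t).
Proof.
move=> bF bG Fs Gt.
have [w Hw] := abs_bounded_has_sum (abs_bounded_prod bF bG).
suff -> : s * t = w by [].
apply: (@has_sum_unique I (fun i => F i * t)).
  by rewrite mulrC; apply: (eq_has_sum _ (has_sumZ (c := t) Fs)) => i; rewrite mulrC.
apply: (has_sum_fiber Hw) => i; apply: has_sum_row => /=.
exact: has_sumZ.
Qed.

(** Bridge between the real bounds used here and the extended-real summability in the definition of
    analyticity. *)
Lemma abs_bounded_summable I (F : I -> R) :
  abs_bounded F <-> summable [set: I] (fun i => (F i)%:E).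
Proof.
have E (A : {fset I}) : (\sum_(i \in [set` A]) `|(F i)%:E| =
    (fsum (fun i => `|F i|) A)%:E)%E.
  rewrite fsbig_finite //= set_fsetK /fsum -sumEFin.
  by apply: eq_bigr.
split.
  move=> [C HC]; apply: (@le_lt_trans _ _ C%:E); last exact: ltry.
  apply: ge_ereal_sup => _ [A [finA _] <-].
  by rewrite -(fset_setK finA) E lee_fin.
rewrite summableE => Fs; exists (fine (\esum_(i in [set: I]) `|(F i)%:E|)%E) => A.
rewrite -lee_fin fineK // -E; apply: ereal_sup_ubound.
by exists [set` A] => //; split.
Qed.

End HasSum.

(** * Multi-indices *)

Section MultiIndex.
Variable n : nat.
Definition mindex := {ffun 'I_n -> nat}.
Implicit Types (a b c : mindex) (i j : 'I_n).

Definition mdegree a : nat := (\sum_i a i)%N.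
Definition mzero : mindex := [ffun _ => 0%N].
Definition munit i : mindex := [ffun j => nat_of_bool (j == i)].
Definition madd a b : mindex := [ffun i => (a i + b i)%N].
Definition msub a b : mindex := [ffun i => (a i - b i)%N].
Definition mle a b : bool := [forall i, a i <= b i]%N.

Lemma mleP a b : reflect (forall i, a i <= b i)%N (mle a b).
Proof. exact: forallP. Qed.

Lemma msubK a b : mle a b -> madd a (msub b a) = b.
Proof. by move=> /mleP h; apply/ffunP => i; rewrite !ffunE subnKC. Qed.

Lemma maddK a b : msub (madd a b) a = b.
Proof. by apply/ffunP => i; rewrite !ffunE addKn. Qed.

Lemma mle_addr a b : mle a (madd a b).
Proof. by apply/mleP => i; rewrite ffunE leq_addr. Qed.

Lemma madd_inj a : injective (madd a).
Proof. by move=> b c e; rewrite -(maddK a b) e maddK. Qed.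

Lemma mle_munit a i : mle (munit i) a = (0 < a i)%N.
Proof.
apply/mleP/idP => [/(_ i)|h j]; rewrite ffunE; first by rewrite eqxx.
by case: eqP => // ->.
Qed.

Lemma mle_mdegree a b : mle a b -> (mdegree a <= mdegree b)%N.
Proof. by move=> /mleP h; apply: leq_sum => i _. Qed.

Lemma mdegree0 : mdegree mzero = 0%N.
Proof. by rewrite /mdegree big1 // => i _; rewrite ffunE. Qed.

Lemma mdegreeD a b : mdegree (madd a b) = (mdegree a + mdegree b)%N.
Proof. by rewrite /mdegree -big_split; apply: eq_bigr => i _; rewrite ffunE. Qed.

Lemma mdegree_unit i : mdegree (munit i) = 1%N.
Proof.
rewrite /mdegree (bigD1 i) //= ffunE eqxx big1 // => j /negbTE ji.
by rewrite ffunE ji.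
Qed.

Lemma leq_mdegree a i : (a i <= mdegree a)%N.
Proof. by rewrite /mdegree (bigD1 i) //= leq_addr. Qed.

Lemma mdegree_eq0 a : (mdegree a == 0%N) = (a == mzero).
Proof.
apply/eqP/eqP => [h|->]; last exact: mdegree0.
apply/ffunP => i; rewrite ffunE; apply/eqP; rewrite -leqn0 -h; exact: leq_mdegree.
Qed.

Lemma mdegree_gt0 a : (0 < mdegree a)%N -> exists i, (0 < a i)%N.
Proof.
case: (boolP [exists i, (0 < a i)%N]) => [/existsP //|/existsPn N].
by rewrite /mdegree big1 // => i _; apply/eqP; have := N i; rewrite -eqn0Ngt.
Qed.

Lemma mdegreeB a b : mle b a -> mdegree (msub a b) = (mdegree a - mdegree b)%N.
Proof. by move=> h; rewrite -{2}(msubK h) mdegreeD addKn. Qed.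

(** Boxes are cofinal among the finite sets of multi-indices, match [pseries_box], and let sums of
    products factor by coordinates. *)
Definition mbox N : {fset mindex} :=
  [fset b in [seq [ffun i => nat_of_ord (t i)] | t : {ffun 'I_n -> 'I_N}]]%fset.

Lemma in_mbox N a : (a \in mbox N) = [forall i, a i < N]%N.
Proof.
rewrite inE /=; apply/mapP/forallP => [[t _ ->] i|h]; first by rewrite ffunE.
exists [ffun i => Ordinal (h i)]; first by rewrite mem_enum.
by apply/ffunP => i; rewrite !ffunE.
Qed.

Lemma mbox_mdegree a N : (mdegree a < N)%N -> a \in mbox N.
Proof.
by move=> h; rewrite in_mbox; apply/forallP => i; apply: leq_ltn_trans h;
   exact: leq_mdegree.
Qed.

Lemma mbox_sub N M : (N <= M)%N -> (mbox N `<=` mbox M)%fset.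
Proof.
move=> NM; apply/fsubsetP => a; rewrite !in_mbox => /forallP h; apply/forallP => i.
exact: leq_trans (h i) NM.
Qed.

Lemma mbox_cofinal (A : {fset mindex}) : exists N, (A `<=` mbox N)%fset.
Proof.
exists (\max_(a <- A) (mdegree a).+1)%N; apply/fsubsetP => a aA.
by apply: mbox_mdegree; rewrite (big_fsetD1 a) //= leq_maxl.
Qed.

Definition mbelow a : {fset mindex} := [fset b in mbox (mdegree a).+1 | mle b a]%fset.

Lemma in_mbelow a b : (b \in mbelow a) = mle b a.
Proof.
rewrite inE inE /=; case: (boolP (mle b a)) => h; rewrite ?andbF ?andbT //.
by apply: mbox_mdegree; rewrite ltnS mle_mdegree.
Qed.

Section MultiBinomial.
Variable A : comNzRingType.

Lemma sum_mbox (F : mindex -> A) N : \sum_(b <- mbox N) F b =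
  \sum_(t : {ffun 'I_n -> 'I_N}) F [ffun i => nat_of_ord (t i)].
Proof.
pose s : seq mindex := [seq [ffun i => nat_of_ord (t i)] | t : {ffun 'I_n -> 'I_N}].
have us : uniq s.
  rewrite map_inj_uniq ?enum_uniq // => t u /ffunP tu; apply/ffunP => i.
  by apply: val_inj; have := tu i; rewrite !ffunE.
rewrite (perm_big s); first by rewrite /s big_image.
by apply: uniq_perm => [||b]; rewrite ?fset_uniq ?inE.
Qed.

Lemma sum_mbox_prod (G : 'I_n -> nat -> A) N :
  \sum_(b <- mbox N) \prod_i G i (b i) = \prod_i \sum_(k < N) G i k.
Proof.
rewrite sum_mbox bigA_distr_bigA /=; apply: eq_bigr => t _.
by apply: eq_bigr => i _; rewrite ffunE.
Qed.

Definition monomial (y : 'I_n -> A) a : A := \prod_i y i ^+ a i.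

Lemma monomialD y a b : monomial y (madd a b) = monomial y a * monomial y b.
Proof. by rewrite /monomial -big_split; apply: eq_bigr => i _; rewrite ffunE exprD. Qed.

Lemma monomial_cst (r : A) a : monomial (fun=> r) a = r ^+ mdegree a.
Proof. by rewrite /monomial /mdegree expr_sum. Qed.

Definition mbinomial a b : A := \prod_i ('C(a i, b i))%:R.

Lemma mbinomial_eq0 a b : ~~ mle b a -> mbinomial a b = 0.
Proof.
rewrite /mle negb_forall => /existsP[i]; rewrite -ltnNge => h.
by rewrite /mbinomial (bigD1 i) //= bin_small // mul0r.
Qed.

(** Summing over a whole box, instead of the b below a, splits the sum into one binomial formula per
    coordinate; the additional terms have a vanishing binomial coefficient. *)
Lemma multi_binomial (x y : 'I_n -> A) a N : a \in mbox N ->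
  \sum_(b <- mbox N) mbinomial a b * monomial x (msub a b) * monomial y b =
  monomial (fun i => x i + y i) a.
Proof.
rewrite in_mbox => /forallP aN.
transitivity (\sum_(b <- mbox N) \prod_i ('C(a i, b i)%:R * x i ^+ (a i - b i)
    * y i ^+ b i)).
  apply: eq_bigr => b _; rewrite /mbinomial /monomial -!big_split /=.
  by apply: eq_bigr => i _; rewrite !ffunE.
rewrite (@sum_mbox_prod (fun i k => 'C(a i, k)%:R * x i ^+ (a i - k) * y i ^+ k)).
rewrite /monomial; apply: eq_bigr => i _; rewrite exprDn.
rewrite (big_ord_widen N (fun k => (x i ^+ (a i - k) * y i ^+ k) *+ 'C(a i, k))) //.
rewrite [RHS]big_mkcond /=; apply: eq_bigr => k _.
case: ltnP => [_|h]; first by rewrite -mulrA mulr_natl.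
by rewrite bin_small // !mul0r.
Qed.

End MultiBinomial.

Section MultiSums.
Variable R : realType.

Lemma has_sum_mbox (F : mindex -> R) s : has_sum F s ->
  fsum F (mbox N) @[N --> \oo] --> s.
Proof.
move=> /has_sumP H; apply/cvgrPdist_le => e e0; have [A HA] := H e e0.
have [M HM] := mbox_cofinal A; exists M => //= N /= MN.
by apply: HA; apply: (fsubset_trans HM); exact: mbox_sub.
Qed.

Lemma ler_monomial (r : R) y a : (forall i, `|y i| <= r) ->
  `|monomial y a| <= r ^+ mdegree a.
Proof.
move=> yr; rewrite -monomial_cst /monomial normr_prod.
apply: ler_prod => i _; rewrite normr_ge0 /= normrX; apply: lerXn2r => //.
by rewrite nnegrE; apply: le_trans (yr i).
Qed.

Lemma mbinomial_ge0 a b : 0 <= mbinomial R a b.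
Proof. by apply: prodr_ge0 => i _; rewrite ler0n. Qed.

End MultiSums.
End MultiIndex.

(** * Convergent power series *)

Section PowerSeries.
Variables (R : realType) (n : nat).
Local Notation V := ('rV[R]_n).
Local Notation mindex := (mindex n).
Implicit Types (a b : mindex -> R) (f g : V -> R) (p q y : V).

Definition cube (r : R) y : Prop := forall i, `|y 0 i| <= r.

Lemma near0_cubeP (P : V -> Prop) :
  (\forall y \near (0 : V), P y) <-> exists2 r, 0 < r & forall y, cube r y -> P y.
Proof.
split.
  move=> /nbhs_ballP[e /= e0 He]; exists (e / 2); first by rewrite divr_gt0.
  move=> y yr; apply: He; split => // i j.
  rewrite /ball /= ord1 mxE sub0r normrN; apply: le_lt_trans (yr j) _; lra.
move=> [r r0 Hr]; apply/nbhs_ballP; exists r => // y [_ yr]; apply: Hr => i.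
by have := yr 0 i; rewrite /ball /= mxE sub0r normrN => /ltW.
Qed.

Lemma cube_le r s y : r <= s -> cube r y -> cube s y.
Proof. by move=> rs yr i; apply: le_trans (yr i) rs. Qed.

Lemma cube_const r : 0 <= r -> cube r (const_mx r).
Proof. by move=> r0 i; rewrite mxE ger0_norm. Qed.

Lemma cube0 r : 0 <= r -> cube r 0.
Proof. by move=> r0 i; rewrite mxE normr0. Qed.

Lemma monomial_const r al : monomial ((const_mx r : V) 0) al = r ^+ mdegree al.
Proof. by rewrite -monomial_cst; apply: eq_bigr => i _; rewrite mxE. Qed.

(** Absolute convergence is recorded at the single corner (r, ..., r), which dominates every point
    of the closed cube. *)
Definition expands (r : R) a f p : Prop :=
  [/\ 0 < r, abs_bounded (fun al => a al * r ^+ mdegree al) &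
      forall y, cube r y -> has_sum (pseries_term a y) (f (p + y))].

Definition has_ps a f p : Prop := exists r, expands r a f p.

Lemma pseries_boxE a y :
  pseries_box a y = fun N => fsum (pseries_term a y) (mbox n N).
Proof. by apply/funext => N; rewrite /fsum sum_mbox. Qed.

Lemma abs_bounded_term r a y : abs_bounded (fun al => a al * r ^+ mdegree al) ->
  cube r y -> abs_bounded (pseries_term a y).
Proof.
move=> H yr; apply: abs_bounded_le H => al.
rewrite /pseries_term !normrM; apply: ler_wpM2l => //.
apply: (le_trans (ler_monomial al yr)); exact: ler_norm.
Qed.

Lemma expands_le r s a f p : 0 < s -> s <= r -> expands r a f p -> expands s a f p.
Proof.
move=> s0 sr [r0 ba H]; split => //.
  apply: abs_bounded_le ba => al; rewrite !normrM; apply: ler_wpM2l => //.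
  rewrite !ger0_norm ?exprn_ge0 ?(ltW s0) ?(ltW r0) //.
  by apply: lerXn2r; rewrite ?nnegrE ?(ltW s0) ?(ltW r0).
by move=> y ys; apply: H; exact: cube_le ys.
Qed.

Lemma analytic_atP f p : analytic_at f p <-> exists a, has_ps a f p.
Proof.
split=> -[a].
  move=> /near0_cubeP[r r0 H]; exists a, r; split => //.
    have cr := cube_const (ltW r0).
    have [/abs_bounded_summable S _] := H _ cr.
    apply: (eq_abs_bounded _ S) => al; congr (_ * _).
    by rewrite -monomial_const.
  move=> y /H[/abs_bounded_summable /abs_bounded_has_sum [s Hs] Hb].
  suff -> : f (p + y) = s by [].
  move: Hb; rewrite pseries_boxE => Hb; exact: (cvg_unique _ Hb (has_sum_mbox Hs)).
move=> [r [r0 ba H]]; exists a; apply/near0_cubeP; exists r => // y yr; split.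
  exact/abs_bounded_summable/(abs_bounded_term ba yr).
rewrite pseries_boxE; exact: has_sum_mbox (H _ yr).
Qed.

(** The coefficient of y^be in the expansion of sum_al a_al (q + y)^al; the default 0 is taken if
    the sum does not exist. *)
Definition recentered a q (be : mindex) : R :=
  xget 0 (has_sum (fun al => a al * (mbinomial R al be * monomial (q 0) (msub al be)))).

(** * Re-expansion of a power series at a nearby point *)

Section Recentering.
Variables (r s : R) (a : mindex -> R) (f : V -> R) (p q : V).
Hypotheses (Ea : expands r a f p) (sr : s < r) (qs : cube s q).

Let F (y : V) (ab : mindex * mindex) : R :=
  a ab.1 * (mbinomial R ab.1 ab.2 * monomial (q 0) (msub ab.1 ab.2))
    * monomial (y 0) ab.2.

Lemma recentering_row y N al : al \in mbox n N ->
  fsum (fun be => F y (al, be)) (mbox n N) = pseries_term a (q + y) al.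
Proof.
move=> alN; rewrite /pseries_term.
rewrite (_ : \prod_i _ = monomial (fun i => q 0 i + y 0 i) al); last first.
  by apply: eq_bigr => i _; rewrite mxE.
rewrite -(multi_binomial _ _ alN) /fsum big_distrr /=.
by apply: eq_bigr => be _; rewrite /F /= !mulrA.
Qed.

(** As |q_i| <= s and |y_i| <= r - s, the binomial formula bounds the row of al by |a_al| (s + (r -
    s))^|al|, a term of the absolutely bounded family at radius r. *)
Lemma abs_bounded_recentering y : cube (r - s) y -> abs_bounded (F y).
Proof.
move=> yrs; have [r0 ba _] := Ea.
apply: (abs_bounded_rows (abs_bounded_norm ba)) => al A.
have [N HN] := mbox_cofinal (al |` A)%fset.
have alN : al \in mbox n N by apply: (fsubsetP HN); rewrite !inE eqxx.
have AN : (A `<=` mbox n N)%fset by apply: fsubset_trans HN; exact: fsubsetUr.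
apply: (le_trans (ler_fsum_sub AN _)) => //.
rewrite normrM (ger0_norm (exprn_ge0 _ (ltW r0))).
have -> : r ^+ mdegree al = monomial (fun _ => s + (r - s)) al.
  by rewrite monomial_cst; congr (_ ^+ _); rewrite addrC subrK.
rewrite -(multi_binomial _ _ alN) /fsum big_distrr /=; apply: ler_sum => be _.
rewrite /F /= -!mulrA !normrM; apply: ler_wpM2l => //.
rewrite ger0_norm ?mbinomial_ge0 //; apply: ler_wpM2l; first exact: mbinomial_ge0.
by apply: ler_pM => //; rewrite monomial_cst; exact: ler_monomial.
Qed.

Lemma abs_bounded_recentered be :
  abs_bounded (fun al => a al * (mbinomial R al be * monomial (q 0) (msub al be))).
Proof.
have c0 : 0 < (r - s) ^+ mdegree be by rewrite exprn_gt0 ?subr_gt0.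
have rs0 : 0 < r - s by rewrite subr_gt0.
have cr := cube_const (ltW rs0).
have h : injective (fun al : mindex => (al, be)) by move=> ? ? [].
have := abs_boundedZ ((r - s) ^- mdegree be)
   (abs_bounded_inj h (abs_bounded_recentering cr)).
apply: eq_abs_bounded => al; rewrite /F /=.
by rewrite monomial_const mulrC mulfK ?gt_eqF.
Qed.

Lemma has_sum_recentered be :
  has_sum (fun al => a al * (mbinomial R al be * monomial (q 0) (msub al be)))
          (recentered a q be).
Proof.
have [t Ht] := abs_bounded_has_sum (abs_bounded_recentered be).
exact: (xgetPex 0 (ex_intro _ t Ht)).
Qed.

Lemma recentering_col y be : has_sum (fun ab => if ab.2 == be then F y ab else 0)
  (pseries_term (recentered a q) y be).
Proof.
apply: has_sum_col; rewrite /F /= /pseries_term -/(monomial (y 0) be) mulrC.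
have := has_sumZ (c := monomial (y 0) be) (has_sum_recentered (be := be)).
by apply: eq_has_sum => al; rewrite mulrC.
Qed.

(** The double family [F y] sums by rows to f(p + q + y) and by columns to the recentered series. *)
Lemma recentering : expands (r - s) (recentered a q) f (p + q).
Proof.
have rs0 : 0 < r - s by rewrite subr_gt0.
split=> //.
  have cr := cube_const (ltW rs0).
  have := abs_bounded_fiber (abs_bounded_recentering cr) (@recentering_col _).
  apply: eq_abs_bounded => be.
  by rewrite /pseries_term -/(monomial _ _) monomial_const.
move=> y yrs; have [t Ht] := abs_bounded_has_sum (abs_bounded_recentering yrs).
have -> : f (p + q + y) = t; last exact: (has_sum_fiber Ht (@recentering_col y)).
have [_ _ H] := Ea.
have qyr : cube r (q + y).
  move=> i; rewrite mxE; apply: le_trans (ler_normD _ _) _.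
  by have := qs i; have := yrs i; lra.
have := H _ qyr; rewrite addrA => H1; apply: (has_sum_unique H1).
apply: (has_sum_fiber Ht) => al; apply: has_sum_row.
have alN := mbox_mdegree (ltnSn (mdegree al)).
rewrite -(recentering_row _ alN).
apply: has_sum_finite => be beN; rewrite /F /= mbinomial_eq0 ?mul0r ?mulr0 ?mul0r //.
apply: contra beN => be_al; apply: mbox_mdegree; rewrite ltnS; exact: mle_mdegree.
Qed.

End Recentering.
End PowerSeries.

(** * Calculus of convergent expansions *)

Section Operations.
Variables (R : realType) (n : nat).
Local Notation V := ('rV[R]_n).
Local Notation mindex := (mindex n).
Implicit Types (a b : mindex -> R) (f g : V -> R) (p q y : V).

Lemma has_ps_cube f a p : has_ps a f p ->
  exists2 r, 0 < r & forall s, 0 < s -> s <= r -> expands s a f p.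
Proof.
by move=> [r Hr]; have [r0 _ _] := Hr; exists r => // s s0 sr; exact: expands_le Hr.
Qed.

Lemma expands_monomial0 f a p r : expands r a f p -> f p = a (mzero n).
Proof.
move=> [r0 _ /(_ 0 (cube0 (ltW r0)))]; rewrite addr0 => H.
apply: (has_sum_unique H).
have E : a (mzero n) = fsum (pseries_term a 0) [fset mzero n]%fset.
  rewrite /fsum big_seq_fset1 /pseries_term big1 ?mulr1 // => i _.
  by rewrite ffunE.
rewrite E; apply: has_sum_finite => al; rewrite inE => al0.
have [i ai] : exists i, (0 < al i)%N.
  by apply: mdegree_gt0; rewrite lt0n mdegree_eq0.
rewrite /pseries_term (bigD1 i) //= mxE expr0n.
by rewrite (gtn_eqF ai) mul0r mulr0.
Qed.

Definition axis (t : R) (i : 'I_n) : V := t *: delta_mx 0 i.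

Lemma cube_axis (t : R) i : cube `|t| (axis t i).
Proof.
move=> j; rewrite !mxE eqxx /= normrM; case: (j == i); first by rewrite normr1 mulr1.
by rewrite normr0 mulr0.
Qed.

(** On the axis only the multiples of the i-th unit index contribute. Those of degree at least 2 are
    bounded by (t/r)^2 times their value at radius r; [h] cancels the constant and linear terms. *)
Lemma expands_remainder f a p r i : expands r a f p -> exists2 C, 0 <= C &
  forall t, `|t| <= r ->
    `|f (p + axis t i) - f p - t * a (munit i)| <= C * t ^+ 2.
Proof.
move=> Er; have [r0 [C HC] H] := Er.
have C0 : 0 <= C by have := HC fset0; rewrite /fsum big_seq_fset0.
exists (C / r ^+ 2); first by rewrite divr_ge0 ?exprn_ge0 // ltW.
move=> t tr; rewrite (expands_monomial0 Er).
have ct := cube_le tr (cube_axis t i).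
have E0 : monomial (axis t i 0) (mzero n) = 1 by rewrite /monomial big1 // => j _; rewrite ffunE.
have E1 : monomial (axis t i 0) (munit i) = t.
  rewrite /monomial (bigD1 i) //= big1 ?mulr1; last first.
    by move=> j /negbTE ji; rewrite !ffunE ji.
  by rewrite !mxE ffunE !eqxx /= mulr1.
have z1 : mzero n != munit i.
  by apply/eqP => /(congr1 (@mdegree n)); rewrite mdegree0 mdegree_unit.
pose h al := if al == mzero n then - a (mzero n) else
             if al == munit i then - (t * a (munit i)) else 0.
have Hh : has_sum h (- a (mzero n) - t * a (munit i)).
  have -> : - a (mzero n) - t * a (munit i) = fsum h [fset mzero n; munit i]%fset.
    rewrite /fsum (big_fsetD1 (mzero n)) ?inE ?eqxx //=.
    rewrite (_ : (_ `\ _)%fset = [fset munit i]%fset); last first.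
      apply/fsetP => al; rewrite !inE; case: (eqVneq al (mzero n)) => //= ->.
      by rewrite (negbTE z1).
    by rewrite big_seq_fset1 /h eqxx eq_sym (negbTE z1) eqxx.
  by apply: has_sum_finite => al; rewrite !inE /h => /norP[/negbTE -> /negbTE ->].
have Hs := has_sumD (H _ ct) Hh.
rewrite -addrA; apply: (has_sum_le_bound Hs) => A.
have -> : C / r ^+ 2 * t ^+ 2 = (t ^+ 2 / r ^+ 2) * C.
  by rewrite mulrC [C / _]mulrC mulrA.
apply: (@le_trans _ _ (t ^+ 2 / r ^+ 2 * fsum (fun al => `|a al * r ^+ mdegree al|) A));
  last by apply: ler_wpM2l => //; rewrite divr_ge0 ?sqr_ge0.
rewrite /fsum big_distrr /=; apply: ler_sum => al _.
have nn : 0 <= t ^+ 2 / r ^+ 2 * `|a al * r ^+ mdegree al|.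
  by rewrite mulr_ge0 // divr_ge0 ?sqr_ge0.
rewrite /pseries_term -/(monomial _ _) /h.
case: (eqVneq al (mzero n)) => [al0|al0].
  by rewrite [in X in X <= _]al0 E0 mulr1 subrr normr0.
case: (eqVneq al (munit i)) => [al1|al1].
  by rewrite [in X in X <= _]al1 E1 mulrC subrr normr0.
rewrite addr0 !normrM mulrCA; apply: ler_wpM2l => //.
case: (boolP [exists j, (j != i) && (0 < al j)%N]) => [/existsP[j /andP[ji aj]]|N].
  rewrite /monomial (bigD1 j) //= !mxE eqxx /= (negbTE ji) mulr0 expr0n.
  by rewrite (gtn_eqF aj) mul0r normr0 mulr_ge0 ?divr_ge0 ?sqr_ge0.
have als j : j != i -> al j = 0%N.
  move=> ji; apply/eqP; rewrite eqn0Ngt; apply: contra N => aj.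
  by apply/existsP; exists j; rewrite ji.
have dE : mdegree al = al i.
  by rewrite /mdegree (bigD1 i) //= big1 ?addn0.
apply: (le_trans (ler_monomial _ (cube_axis t i))).
have [k kE] : exists k, mdegree al = k.+2.
  case E : (mdegree al) => [|[|k]]; last by exists k.
    by rewrite -mdegree_eq0 E in al0.
  case/eqP: al1; apply/ffunP => j; rewrite ffunE; case: eqVneq => [->|/als //].
  by rewrite -dE.
rewrite kE (ger0_norm (exprn_ge0 _ (ltW r0))) -(addn2 k) !exprD.
rewrite real_normK ?num_real // [X in X <= _]mulrC -[X in _ <= X]mulrA.
apply: ler_wpM2l; first exact: sqr_ge0.
rewrite mulrCA mulVf ?mulr1 ?expf_neq0 ?gt_eqF //.
by apply: lerXn2r => //; rewrite nnegrE // ltW.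
Qed.

Lemma expands_derive f a p r i : expands r a f p ->
  is_derive p (delta_mx 0 i) f (a (munit i)).
Proof.
move=> Er; have [C C0 H] := expands_remainder i Er; have [r0 _ _] := Er.
suff cv : h^-1 *: (f (h *: delta_mx 0 i + p) - f p) @[h --> 0^'] --> a (munit i).
  by apply: DeriveDef; [apply/cvg_ex; exists (a (munit i))|exact: cvg_lim cv].
apply/cvgrPdist_le => e e0; near=> h.
have h0 : h != 0 by near: h; exact: nbhs_dnbhs_neq.
have hr : `|h| <= r by near: h; apply: dnbhs0_le.
have he : `|h| <= e / (C + 1) by near: h; apply: dnbhs0_le; rewrite divr_gt0 ?ltr_wpDl.
have := H _ hr; rewrite /axis (addrC p) => Hh.
rewrite distrC -[X in _ - X](mulKf h0) -[_ *: _]/(h^-1 * _) -mulrBr normrM normfV.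
rewrite ler_pdivrMl ?normr_gt0 //; apply: (le_trans Hh).
rewrite -(@real_normK _ h) ?num_real // expr2 mulrA mulrC.
apply: ler_wpM2l => //; apply: (@le_trans _ _ ((C + 1) * (e / (C + 1)))).
  by apply: ler_pM => //; lra.
by rewrite mulrC divfK // gt_eqF // ltr_wpDl.
Unshelve. all: by end_near. Qed.

Definition pderiv i a (al : mindex) : R := (al i).+1%:R * a (madd (munit i) al).

(** Termwise differentiation is avoided: at p + y the derivative is the linear coefficient of the
    series recentered at y, and the sum defining that coefficient, reindexed by al -> e_i + al, is
    the value at y of the derived series. *)
Lemma has_ps_partial f a i p : has_ps a f p -> has_ps (pderiv i a) (partial i f) p.
Proof.
move=> [r Er]; have [r0 _ _] := Er.
have r20 : 0 < r / 2 by rewrite divr_gt0.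
have r2r : r / 2 < r by lra.
pose G y al := a al * (mbinomial R al (munit i) * monomial (y 0) (msub al (munit i))).
have E y al : G y (madd (munit i) al) = pseries_term (pderiv i a) y al.
  rewrite /G maddK /pseries_term /pderiv -/(monomial (y 0) al).
  rewrite (_ : mbinomial R _ _ = (al i).+1%:R); first by rewrite mulrCA mulrA.
  rewrite /mbinomial (bigD1 i) //= !ffunE eqxx bin1 big1 ?mulr1 ?add1n // => j ji.
  by rewrite !ffunE (negbTE ji) bin0.
have inj := madd_inj (a := munit i).
exists (r / 2); split=> //.
  have := abs_bounded_inj inj
    (abs_bounded_recentered Er r2r (cube_const (ltW r20)) (munit i)).
  by apply: eq_abs_bounded => al; rewrite /= -/(G _ _) E /pseries_term -/(monomial _ _)
    monomial_const.
move=> y yr; rewrite /partial.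
have Ey := recentering Er r2r yr.
rewrite (@derive_val _ _ _ _ _ _ _ (expands_derive i Ey)).
apply: (eq_has_sum (E y)); apply/(has_sum_inj (F := G y) _ inj).
  move=> al N; rewrite /G mbinomial_eq0 ?mul0r ?mulr0 //.
  by apply/negP => /msubK; exact: N.
exact: (has_sum_recentered Er r2r yr).
Qed.

Lemma abs_bounded_finite (I : choiceType) (F : I -> R) (B : {fset I}) :
  (forall i, i \notin B -> F i = 0) -> abs_bounded F.
Proof.
move=> F0; exists (fsum (fun i => `|F i|) B) => A.
apply: (@le_trans _ _ (fsum (fun i => `|F i|) (A `|` B)%fset)).
  by apply: ler_fsum_sub => //; exact: fsubsetUl.
rewrite (@fsum_sub _ _ _ B) ?fsubsetUr // => i _ /F0 ->; exact: normr0.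
Qed.

Lemma has_ps_cst (c : R) p :
  has_ps (fun al => if al == mzero n then c else 0) (fun=> c) p.
Proof.
exists 1; split=> [//||y _].
  apply: (@abs_bounded_finite _ _ [fset mzero n]%fset) => al.
  by rewrite inE => /negbTE ->; rewrite mul0r.
have E : fsum (pseries_term (fun al => if al == mzero n then c else 0) y)
    [fset mzero n]%fset = c.
  rewrite /fsum big_seq_fset1 /pseries_term eqxx big1 ?mulr1 // => i _.
  by rewrite ffunE.
rewrite -[X in has_sum _ X]E; apply: has_sum_finite => al.
by rewrite inE /pseries_term => /negbTE ->; rewrite mul0r.
Qed.

Lemma has_psZ (c : R) a f p : has_ps a f p ->
  has_ps (fun al => c * a al) (fun x => c * f x) p.
Proof.
move=> [r [r0 ba H]]; exists r; split=> // [|y /H Hy].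
  by apply: eq_abs_bounded (abs_boundedZ c ba) => al; rewrite mulrA.
by apply: eq_has_sum (has_sumZ (c := c) Hy) => al; rewrite /pseries_term mulrA.
Qed.

Lemma has_psD a b f g p : has_ps a f p -> has_ps b g p ->
  has_ps (fun al => a al + b al) (fun x => f x + g x) p.
Proof.
move=> /has_ps_cube[r r0 Hr] /has_ps_cube[s s0 Hs].
have t0 : 0 < Num.min r s by rewrite lt_min r0.
have [|_ ba Ha] := Hr _ t0; first by rewrite ge_min lexx.
have [|_ bb Hb] := Hs _ t0; first by rewrite ge_min lexx orbT.
exists (Num.min r s); split=> // [|y yt].
  by apply: eq_abs_bounded (abs_boundedD ba bb) => al; rewrite mulrDl.
by apply: eq_has_sum (has_sumD (Ha _ yt) (Hb _ yt)) => al; rewrite /pseries_term mulrDl.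
Qed.

Lemma has_psB a b f g p : has_ps a f p -> has_ps b g p ->
  has_ps (fun al => a al - b al) (fun x => f x - g x) p.
Proof.
move=> Ha /(has_psZ (-1)) /(has_psD Ha).
rewrite (_ : (fun al => _) = (fun al => a al - b al)); last first.
  by apply/funext => al; rewrite mulN1r.
rewrite (_ : (fun x => _ + _) = (fun x => f x - g x)) //.
by apply/funext => x; rewrite mulN1r.
Qed.

Lemma has_ps_sum (I : Type) (r : seq I) (a : I -> mindex -> R) (f : I -> V -> R) p :
  (forall i, has_ps (a i) (f i) p) ->
  has_ps (fun al => \sum_(i <- r) a i al) (fun x => \sum_(i <- r) f i x) p.
Proof.
move=> H; elim: r => [|i r IH].
  have := has_ps_cst 0 p; congr (has_ps _ _ _); apply/funext => z.
    by rewrite big_nil if_same.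
  by rewrite big_nil.
have := has_psD (H i) IH; congr (has_ps _ _ _); apply/funext => z;
  by rewrite big_cons.
Qed.

Definition mconv a b (al : mindex) : R := fsum (fun be => a be * b (msub al be)) (mbelow al).

Lemma has_psM a b f g p : has_ps a f p -> has_ps b g p ->
  has_ps (mconv a b) (fun x => f x * g x) p.
Proof.
move=> /has_ps_cube[r r0 Hr] /has_ps_cube[s s0 Hs].
have t0 : 0 < Num.min r s by rewrite lt_min r0.
have [|_ ba Ha] := Hr _ t0; first by rewrite ge_min lexx.
have [|_ bb Hb] := Hs _ t0; first by rewrite ge_min lexx orbT.
set t := Num.min r s in t0 ba bb Ha Hb *.
pose F y (bc : mindex * mindex) := pseries_term a y bc.1 * pseries_term b y bc.2.
(* Cauchy product: the double series is regrouped along the fibers of [madd], the fiber over al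
   being parametrized by the be below al. *)
have fib y al : has_sum (fun bc => if madd bc.1 bc.2 == al then F y bc else 0)
    (pseries_term (mconv a b) y al).
  pose h (be : mindex) := (be, msub al be).
  have hi : injective h by move=> ? ? [].
  apply/(has_sum_inj (F := fun bc => if madd bc.1 bc.2 == al then F y bc else 0) _ hi).
    move=> [be ga] N /=; case: eqP => // E; case: (N be).
    by rewrite /h -E maddK.
  have -> : pseries_term (mconv a b) y al =
      fsum ((fun bc => if madd bc.1 bc.2 == al then F y bc else 0) \o h) (mbelow al).
    rewrite /pseries_term /mconv /fsum big_distrl /=; apply: eq_big_seq => be.
    rewrite in_mbelow => /msubK E; rewrite E eqxx /F /pseries_term /= mulrACA.
    by congr (_ * _); rewrite -[in LHS]E -!/(monomial _ _) monomialD.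
  apply: has_sum_finite => be; rewrite in_mbelow => N /=; case: eqP => // E.
  by rewrite -E mle_addr in N.
exists t; split=> // [|y yt].
  have ct : cube t (const_mx t : V) := cube_const (ltW t0).
  have := abs_bounded_fiber (abs_bounded_prod (abs_bounded_term ba ct)
    (abs_bounded_term bb ct)) (@fib _).
  by apply: eq_abs_bounded => al; rewrite /pseries_term -/(monomial _ _) monomial_const.
exact: (has_sum_fiber (has_sum_prod (abs_bounded_term ba yt)
    (abs_bounded_term bb yt) (Ha _ yt) (Hb _ yt)) (@fib y)).
Qed.

(** A coefficient of positive degree is, up to a nonzero integer factor, a coefficient one degree
    lower of a partial derivative, and that derivative still vanishes near 0. *)
Lemma has_ps_eq0 a f : has_ps a f 0 -> (\forall x \near (0 : V), f x = 0) ->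
  forall al, a al = 0.
Proof.
move=> Ha Hf al; move Ed : (mdegree al) => d.
elim: d a f Ha Hf al Ed => [|d IH] a f Ha Hf al Ed.
  have [r Er] := Ha; move/eqP: Ed; rewrite mdegree_eq0 => /eqP ->.
  by rewrite -(expands_monomial0 Er); exact: nbhs_singleton Hf.
have [i ai] : exists i, (0 < al i)%N by apply: mdegree_gt0; rewrite Ed.
have aE : madd (munit i) (msub al (munit i)) = al by apply: msubK; rewrite mle_munit.
have H1 := has_ps_partial i Ha.
have : pderiv i a (msub al (munit i)) = 0.
  apply: IH H1 _ _ _.
    apply: filterS (near_join Hf) => x Hx.
    by rewrite /partial (@near_eq_derive _ _ _ _ (cst 0)) ?derive_cst.
  by rewrite mdegreeB ?mle_munit // Ed mdegree_unit subn1.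
by rewrite /pderiv aE => /eqP; rewrite mulf_eq0 pnatr_eq0 /= => /eqP.
Qed.

Lemma eq_has_ps a b f p : a =1 b -> has_ps a f p -> has_ps b f p.
Proof. by move=> /funext ->. Qed.

Lemma has_ps_uniq a b f g : has_ps a f 0 -> has_ps b g 0 -> eq_germ f g -> a =1 b.
Proof.
move=> Ha Hb fg al; apply/eqP; rewrite -subr_eq0; apply/eqP.
apply: (has_ps_eq0 (has_psB Ha Hb)); apply: filterS fg => x ->; exact: subrr.
Qed.

Lemma has_ps_germ a f g : has_ps a f 0 -> has_ps a g 0 -> eq_germ f g.
Proof.
move=> /has_ps_cube[r r0 Hr] /has_ps_cube[s s0 Hs].
have t0 : 0 < Num.min r s by rewrite lt_min r0.
have [|_ _ Hf] := Hr _ t0; first by rewrite ge_min lexx.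
have [|_ _ Hg] := Hs _ t0; first by rewrite ge_min lexx orbT.
apply/near0_cubeP; exists (Num.min r s) => // y yt.
by have := has_sum_unique (Hf _ yt) (Hg _ yt); rewrite add0r.
Qed.

(** By recentering, one expansion at 0 yields expansions at all points of a cube of half the
    radius. *)
Lemma analytic_around0P f : analytic_around0 f <-> exists a, has_ps a f 0.
Proof.
split; first by move=> /nbhs_singleton /analytic_atP.
move=> [a [r Er]]; have [r0 _ _] := Er; apply/near0_cubeP.
have r20 : 0 < r / 2 by rewrite divr_gt0.
have r2r : r / 2 < r by lra.
exists (r / 2) => // q qr; apply/analytic_atP.
exists (recentered a q), (r - r / 2).
by have := recentering Er r2r qr; rewrite add0r.
Qed.

(** Continuity at 0, needed for positive definiteness: passing from radius r to t multiplies each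
    nonconstant term by at most t/r. *)
Lemma has_ps_small a f (e : R) : has_ps a f 0 -> 0 < e ->
  \forall x \near (0 : V), `|f x - a (mzero n)| <= e.
Proof.
move=> [r Er] e0; have [r0 [C HC] H] := Er.
have C0 : 0 <= C by have := HC fset0; rewrite /fsum big_seq_fset0.
have C1 : 0 < C + 1 by lra.
pose t := Num.min r (e * r / (C + 1)).
have t0 : 0 < t by rewrite lt_min r0 /= divr_gt0 ?mulr_gt0.
have tr : t <= r by rewrite ge_min lexx.
apply/near0_cubeP; exists t => // y yt.
pose h al := if al == mzero n then - a (mzero n) else 0.
have Hh : has_sum h (- a (mzero n)).
  have E : fsum h [fset mzero n]%fset = - a (mzero n).
    by rewrite /fsum big_seq_fset1 /h eqxx.
  rewrite -[X in has_sum _ X]E; apply: has_sum_finite => al.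
  by rewrite inE /h => /negbTE ->.
have := has_sumD (H _ (cube_le tr yt)) Hh; rewrite add0r => Hs.
apply: (has_sum_le_bound Hs) => A.
apply: (@le_trans _ _ (t / r * fsum (fun al => `|a al * r ^+ mdegree al|) A)).
  rewrite /fsum big_distrr /=; apply: ler_sum => al _.
  have nn : 0 <= t / r * `|a al * r ^+ mdegree al|.
    by rewrite mulr_ge0 ?divr_ge0 ?(ltW t0) ?(ltW r0).
  rewrite /pseries_term -/(monomial _ _) /h.
  case: (eqVneq al (mzero n)) => [al0|al0].
    rewrite [in X in X <= _]al0 /monomial big1 ?mulr1 ?subrr ?normr0 // => i _.
    by rewrite ffunE.
  rewrite addr0 !normrM mulrCA; apply: ler_wpM2l => //.
  apply: (le_trans (ler_monomial _ yt)).
  rewrite (ger0_norm (exprn_ge0 _ (ltW r0))).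
  case E : (mdegree al) => [|k]; first by rewrite -mdegree_eq0 E in al0.
  rewrite !exprS mulrA divfK ?gt_eqF // ler_pM2l //.
  by apply: lerXn2r; rewrite ?nnegrE ?(ltW t0) ?(ltW r0).
apply: (@le_trans _ _ (e / (C + 1) * C)).
  apply: ler_pM => //; first by rewrite divr_ge0 ?ltW.
    by apply: sumr_ge0.
  rewrite ler_pdivrMr // mulrAC; by rewrite ge_min lexx orbT.
by rewrite mulrAC ler_pdivrMr // ler_pM2l //; lra.
Qed.

(** The default 0 where the series has no sum is invisible to germs. *)
Definition psum a y : R := xget 0 (has_sum (pseries_term a y)).

Lemma has_ps_psum a r : 0 < r -> abs_bounded (fun al => a al * r ^+ mdegree al) ->
  has_ps a (psum a) 0.
Proof.
move=> r0 ba; exists r; split=> // y yr; rewrite add0r.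
have [t Ht] := abs_bounded_has_sum (abs_bounded_term ba yr).
exact: (xgetPex 0 (ex_intro _ t Ht)).
Qed.

End Operations.

(** * Restriction of series to the hyperplane x^1 = 0 *)

Section Restriction.
Variables (R : realType) (m : nat).
Implicit Types (be : mindex m).

(** The multi-index (0, be): the exponents of the monomials that survive on x^1 = 0. *)
Definition mcons0 be : mindex m.+1 :=
  [ffun i => if unlift ord0 i is Some j then be j else 0%N].

Lemma mcons0_lift be j : mcons0 be (lift ord0 j) = be j.
Proof. by rewrite ffunE liftK. Qed.

Lemma mcons0_ord0 be : mcons0 be ord0 = 0%N.
Proof. by rewrite ffunE unlift_none. Qed.

Lemma mcons0_inj : injective mcons0.
Proof.
by move=> a b /ffunP ab; apply/ffunP => j; have := ab (lift ord0 j); rewrite !mcons0_lift.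
Qed.

Lemma mcons0_surj (al : mindex m.+1) : al ord0 = 0%N -> exists be, mcons0 be = al.
Proof.
move=> al0; exists [ffun j => al (lift ord0 j)]; apply/ffunP => i.
case: (unliftP ord0 i) => [j|] ->; first by rewrite mcons0_lift ffunE.
by rewrite mcons0_ord0.
Qed.

Lemma mdegree_mcons0 be : mdegree (mcons0 be) = mdegree be.
Proof.
rewrite /mdegree big_ord_recl mcons0_ord0; apply: eq_bigr => j _.
exact: mcons0_lift.
Qed.

Lemma hyperplane_ord0 (y : 'rV[R]_m) : hyperplane y 0 ord0 = 0.
Proof.
transitivity (hyperplane y 0 (lshift m (ord0 : 'I_1))).
  by congr (hyperplane y 0 _); apply: val_inj.
by apply: (etrans (row_mxEl (0 : 'rV[R]_1) y 0 ord0)); rewrite mxE.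
Qed.

Lemma hyperplane_lift (y : 'rV[R]_m) j : hyperplane y 0 (lift ord0 j) = y 0 j.
Proof.
transitivity (hyperplane y 0 (rshift 1 j)); first by rewrite rshift1.
exact: (row_mxEr (0 : 'rV[R]_1) y).
Qed.

Lemma has_ps_hyperplane a (f : 'rV[R]_m.+1 -> R) : has_ps a f 0 ->
  has_ps (a \o mcons0) (fun y => f (hyperplane y)) 0.
Proof.
move=> [r [r0 ba H]]; exists r; split=> // [|y yr].
  have := abs_bounded_inj mcons0_inj ba.
  by apply: eq_abs_bounded => be; rewrite /= mdegree_mcons0.
have hr : cube r (hyperplane y).
  move=> i; case: (unliftP ord0 i) => [j|] ->; first by rewrite hyperplane_lift.
  by rewrite hyperplane_ord0 normr0 ltW.
have := H _ hr; rewrite !add0r => Hs.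
have E be : pseries_term a (hyperplane y) (mcons0 be) = pseries_term (a \o mcons0) y be.
  rewrite /pseries_term big_ord_recl mcons0_ord0 expr0 mul1r; congr (_ * _).
  by apply: eq_bigr => j _; rewrite mcons0_lift hyperplane_lift.
apply: (eq_has_sum E).
apply/(has_sum_inj (F := pseries_term a (hyperplane y)) _ mcons0_inj) => // al N.
rewrite /pseries_term big_ord_recl hyperplane_ord0 expr0n.
case: eqP => [/mcons0_surj[be /N]//|_]; by rewrite mul0r mulr0.
Qed.

End Restriction.

(** * Majorants *)

Section Multinomial.
Variables (R : realType) (n : nat).
Local Notation mindex := (mindex n).
Implicit Types (al be : mindex) (i : 'I_n).

(** The coefficient of x^al in (x_1 + ... + x_n)^|al|. *)
Definition multinomial al : R := (mdegree al)`!%:R / \prod_i (al i)`!%:R.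

Lemma prod_fact_neq0 al : \prod_i (al i)`!%:R != 0 :> R.
Proof. by apply/prodf_neq0 => i _; rewrite pnatr_eq0 -lt0n fact_gt0. Qed.

(** Comparison of coefficients in d_i s^(k+1) = (k+1) s^k, where s is the sum of the variables. *)
Lemma multinomial_munit al i :
  (al i).+1%:R * multinomial (madd (munit i) al) = (mdegree al).+1%:R * multinomial al.
Proof.
rewrite /multinomial mdegreeD mdegree_unit add1n factS natrM.
have -> : \prod_j (madd (munit i) al j)`!%:R = (al i).+1%:R * \prod_j (al j)`!%:R :> R.
  rewrite (bigD1 i) //= [in RHS](bigD1 i) //= !ffunE eqxx add1n factS natrM mulrA.
  by congr (_ * _); apply: eq_bigr => j /negbTE ji; rewrite !ffunE ji.
have h1 := prod_fact_neq0 al.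
have h2 : (al i).+1%:R != 0 :> R by rewrite pnatr_eq0.
move: h1 h2; move: (_%:R : R) (\prod_i _) => x y h1 h2.
by field; rewrite h1 h2.
Qed.

Lemma multinomial0 : multinomial (mzero n) = 1.
Proof.
rewrite /multinomial mdegree0 big1 ?divr1 ?fact0 // => i _; by rewrite ffunE.
Qed.

Lemma multinomial_gt0 al : 0 < multinomial al.
Proof.
by rewrite divr_gt0 ?ltr0n ?fact_gt0 // prodr_gt0 // => i _; rewrite ltr0n fact_gt0.
Qed.

Lemma multinomial_ge1 al : 1 <= multinomial al.
Proof.
move Ed : (mdegree al) => d; elim: d al Ed => [|d IH] al Ed.
  by move/eqP: Ed; rewrite mdegree_eq0 => /eqP ->; rewrite multinomial0.
have [i ai] : exists i, (0 < al i)%N by apply: mdegree_gt0; rewrite Ed.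
have aE : madd (munit i) (msub al (munit i)) = al by apply: msubK; rewrite mle_munit.
set be := msub al (munit i) in aE.
have db : mdegree be = d by move: Ed; rewrite -aE mdegreeD mdegree_unit => -[].
have := multinomial_munit be i; rewrite aE db => E.
have h : (be i).+1%:R <= d.+1%:R :> R by rewrite ler_nat ltnS -db leq_mdegree.
have b0 : 0 < (be i).+1%:R :> R by rewrite ltr0n.
rewrite -(ler_pM2l b0) E mulr1; apply: (le_trans h).
by rewrite ler_peMr ?IH.
Qed.

Lemma multinomial_le al : multinomial al <= n%:R ^+ mdegree al.
Proof.
move Ed : (mdegree al) => d; elim: d al Ed => [|d IH] al Ed.
  by move/eqP: Ed; rewrite mdegree_eq0 => /eqP ->; rewrite multinomial0.
(* Some exponent is at least the mean |al|/n: otherwise summing the reverse inequalities gives n =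
   0. *)
have [i ai] : exists i, (mdegree al <= n * al i)%N.
  apply/existsP; apply: contraT => /existsPn N.
  have h i : (n * al i + 1 <= d.+1)%N by have := N i; rewrite Ed -ltnNge addn1.
  have : (\sum_(i < n) (n * al i + 1) <= \sum_(i < n) d.+1)%N by apply: leq_sum.
  rewrite big_split /= -big_distrr /= -/(mdegree al) Ed !sum_nat_const card_ord muln1.
  rewrite -[X in (_ <= X)%N]addn0 leq_add2l leqn0 => /eqP n0.
  move: Ed; rewrite /mdegree big1 // => i _; by have := leq_ltn_trans (leq0n i) (ltn_ord i); rewrite [X in (_ < X)%N]n0.
have ai0 : (0 < al i)%N by move: ai; rewrite Ed; case: (al i) => //; rewrite muln0.
have aE : madd (munit i) (msub al (munit i)) = al by apply: msubK; rewrite mle_munit.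
set be := msub al (munit i) in aE.
have db : mdegree be = d by move: Ed; rewrite -aE mdegreeD mdegree_unit => -[].
have alE : al i = (be i).+1 by rewrite -[in LHS]aE !ffunE eqxx add1n.
have := multinomial_munit be i; rewrite aE db => E.
have b0 : 0 < (be i).+1%:R :> R by rewrite ltr0n.
have h : d.+1%:R <= n%:R * (be i).+1%:R :> R by rewrite -natrM ler_nat -alE -Ed.
rewrite -(ler_pM2l b0) E exprS [X in _ <= X]mulrCA [X in _ <= X]mulrA.
by apply: ler_pM => //; [exact: ltW (multinomial_gt0 be)|exact: IH].
Qed.

(* Vandermonde's identity, read off from the coefficients of
   (1 + X)^(al_1) ... (1 + X)^(al_n) = (1 + X)^|al|. *)
Lemma multi_Vandermonde al p :
  \sum_(be <- mbelow al) (if mdegree be == p then mbinomial R al be else 0) =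
  'C(mdegree al, p)%:R.
Proof.
have alN := mbox_mdegree (ltnSn (mdegree al)).
have := multi_binomial (fun=> 1 : {poly R}) (fun=> 'X) alN.
rewrite monomial_cst => /(congr1 (fun P : {poly R} => P`_p)).
rewrite exprDn !coef_sum => E.
have -> : 'C(mdegree al, p)%:R =
    \sum_(i < (mdegree al).+1) (1 ^+ (mdegree al - i) * 'X ^+ i *+ 'C(mdegree al, i) : {poly R})`_p.
  rewrite (eq_bigr (fun i : 'I_(mdegree al).+1 =>
      if i == p :> nat then 'C(mdegree al, i)%:R else 0)); last first.
    by move=> i _; rewrite expr1n mul1r coefMn coefXn eq_sym; case: eqP => _; rewrite ?mul0rn.
  rewrite -big_mkcond /=; case: (ltnP p (mdegree al).+1) => hp.
    by rewrite (big_pred1 (Ordinal hp)).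
  rewrite bin_small // big1 // => i /eqP ip; move: (ltn_ord i); rewrite ip.
  by rewrite ltnNge hp.
rewrite -E.
transitivity (\sum_(be <- mbox n (mdegree al).+1)
    (if mdegree be == p then mbinomial R al be else 0)).
  apply: big_fset_incl; first by apply/fsubsetP => be; rewrite inE inE => /andP[].
  by move=> be _; rewrite in_mbelow => h; rewrite mbinomial_eq0 ?if_same.
apply: eq_bigr => be _.
rewrite [monomial (fun=> 1) _]big1; last by move=> i _; rewrite expr1n.
rewrite mulr1 monomial_cst.
have -> : mbinomial {poly R} al be = (mbinomial R al be)%:P.
  by rewrite /mbinomial rmorph_prod; apply: eq_bigr => i _; rewrite rmorph_nat.
by rewrite coefCM coefXn eq_sym; case: eqP => _; rewrite ?mulr1 ?mulr0.
Qed.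

(** Reduces a convolution over multi-indices to one over degrees. *)
Lemma sum_mbinomial_degree al (g : nat -> R) :
  \sum_(be <- mbelow al) mbinomial R al be * g (mdegree be) =
  \sum_(p < (mdegree al).+1) 'C(mdegree al, p)%:R * g p.
Proof.
transitivity (\sum_(be <- mbelow al) \sum_(p < (mdegree al).+1)
    (if mdegree be == p then mbinomial R al be else 0) * g p).
  apply: eq_big_seq => be; rewrite in_mbelow => /mle_mdegree h.
  have hd : (mdegree be < (mdegree al).+1)%N by [].
  rewrite (bigD1 (Ordinal hd)) //= eqxx big1 ?addr0 // => p /eqP hp.
  case: eqP => [E|_]; last by rewrite mul0r.
  by case: hp; apply: val_inj.
rewrite exchange_big /=; apply: eq_bigr => p _.
by rewrite -big_distrl /= multi_Vandermonde.

Qed.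

End Multinomial.

(** Separates, in the product of two multinomials, the factor summed by Vandermonde's identity from
    a factor depending on the degrees only. *)
Lemma multinomial_mbinomial (R : realType) n (al be : mindex n) : mle be al ->
  multinomial R be * multinomial R (msub al be) =
  multinomial R al * (mbinomial R al be / 'C(mdegree al, mdegree be)%:R).
Proof.
move=> bal; have h := mle_mdegree bal.
have E1 : 'C(mdegree al, mdegree be)%:R =
    (mdegree al)`!%:R / ((mdegree be)`!%:R * (mdegree al - mdegree be)`!%:R) :> R.
  by rewrite -natrM -(bin_fact h) natrM mulfK // pnatr_eq0 -lt0n muln_gt0 ?fact_gt0.
have E2 : mbinomial R al be = \prod_i (al i)`!%:R /
    (\prod_i (be i)`!%:R * \prod_i (msub al be i)`!%:R).
  rewrite /mbinomial -big_split -prodf_div; apply: eq_bigr => i _.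
  have hi : (be i <= al i)%N by apply/mleP.
  by rewrite ffunE /= -natrM -(bin_fact hi) natrM mulfK // pnatr_eq0 -lt0n muln_gt0 ?fact_gt0.
rewrite /multinomial E1 E2 (mdegreeB bal).
have f0 k : k`!%:R != 0 :> R by rewrite pnatr_eq0 -lt0n fact_gt0.
have := prod_fact_neq0 R al; have := prod_fact_neq0 R be.
have := prod_fact_neq0 R (msub al be).
have := f0 (mdegree al); have := f0 (mdegree be).
have := f0 (mdegree al - mdegree be)%N.
move: (\prod_i (msub al be i)`!%:R : R) (\prod_i (al i)`!%:R : R).
move: (\prod_i (be i)`!%:R : R) => x y z.
move: (_`!%:R : R) (_`!%:R : R) (_`!%:R : R) => u v w u0 v0 w0 x0 y0 z0.
by field; rewrite ?u0 ?v0 ?w0 ?x0 ?y0 ?z0.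
Qed.

(** * The majorants Phi and Psi *)

Section Weights.
Variables (R : realType) (n : nat) (i0 : 'I_n).
Local Notation mindex := (mindex n).
Implicit Types (al be : mindex) (i : 'I_n) (a b : mindex -> R).

(* [lam] stretches the coordinate [i0]; [rho] is an inverse radius. *)
Definition weight (rho lam : R) al : R :=
  multinomial R al * lam ^+ al i0 * rho ^+ mdegree al.

Definition Phi rho lam al : R := weight rho lam al / (mdegree al).+1%:R ^+ 2.
Definition Psi rho lam al : R := weight rho lam al / (mdegree al).+1%:R.

(** Origin of the constant 4 in the bound of Phi Psi. With x = p + 1 and y = N - p + 1, a term
    multiplied by N + 1 is (x + y - 1)/(x^2 y), which is below 1/x^2 + (1/x + 1/y)/(x + y). The
    first parts sum to at most 2 by telescoping, the second ones to at most 2 because the harmonic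
    sum is at most N + 1. *)
Lemma conv_weights N : \sum_(p < N.+1) (p.+1%:R ^- 2 / (N - p).+1%:R) <= 4 / N.+1%:R :> R.
Proof.
have tele M : \sum_(p < M.+1) p.+1%:R ^- 2 <= 2 - M.+1%:R^-1 :> R.
  elim: M => [|M IH]; first by rewrite big_ord1 expr1n invr1; lra.
  rewrite big_ord_recr /=; apply: (le_trans (lerD IH (lexx _))).
  have h1 : 0 < M.+1%:R :> R by rewrite ltr0n.
  have -> : M.+2%:R = M.+1%:R + 1 :> R by rewrite -natr1.
  move: h1; move: (M.+1%:R : R) => x x0.
  rewrite -subr_ge0.
  have -> : 2 - (x + 1)^-1 - (2 - x^-1 + (x + 1) ^- 2) = (x * (x + 1) ^+ 2)^-1.
    by field; rewrite !gt_eqF //; lra.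
  by rewrite invr_ge0 mulr_ge0 ?sqr_ge0 ?ltW.
have N0 : 0 < N.+1%:R :> R by rewrite ltr0n.
rewrite ler_pdivlMr // big_distrl /=.
have sym : \sum_(p < N.+1) (N - p).+1%:R^-1 = \sum_(p < N.+1) p.+1%:R^-1 :> R.
  by rewrite (reindex_inj rev_ord_inj) /=; apply: eq_bigr => p _; rewrite subSS subKn // -ltnS.
have h1 : \sum_(p < N.+1) p.+1%:R^-1 <= N.+1%:R :> R.
  rewrite -[X in _ <= X]mulr1 mulr_natl -[X in (_ *+ X)]card_ord -sumr_const.
  by apply: ler_sum => p _; rewrite invf_le1 ?ltr0n // ler1n.
apply: (@le_trans _ _ (\sum_(p < N.+1) (p.+1%:R ^- 2 +
   N.+2%:R^-1 * (p.+1%:R^-1 + (N - p).+1%:R^-1)))).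
  apply: ler_sum => p _.
  have -> : N.+2%:R = p.+1%:R + (N - p).+1%:R :> R.
    by rewrite -natrD addSn addnS subnKC // -ltnS.
  have -> : N.+1%:R = p.+1%:R + (N - p).+1%:R - 1 :> R.
    by rewrite -natrD addSn addnS subnKC -1?ltnS // -(natr1 N.+1) addrK.
  have : 1 <= p.+1%:R :> R by rewrite ler1n.
  have : 1 <= (N - p).+1%:R :> R by rewrite ler1n.
  move: (p.+1%:R : R) ((N - p).+1%:R : R) => x y y1 x1.
  rewrite -subr_ge0.
  have -> : x ^- 2 + (x + y)^-1 * (x^-1 + y^-1) - x ^- 2 / y * (x + y - 1) =
     (x ^+ 2 * y)^-1.
    by field; rewrite !gt_eqF //; lra.
  by rewrite invr_ge0 mulr_ge0 ?sqr_ge0 //; lra.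
rewrite big_split /= -big_distrr /= big_split /= sym.
have h2 : N.+2%:R^-1 * (\sum_(p < N.+1) p.+1%:R^-1 + \sum_(p < N.+1) p.+1%:R^-1) <= 2 :> R.
  rewrite mulrC ler_pdivrMr ?ltr0n //.
  have : N.+1%:R <= N.+2%:R :> R by rewrite ler_nat.
  by move: h1; lra.
have h3 := tele N; have h4 : 0 <= N.+1%:R^-1 :> R by rewrite invr_ge0 ltW.
apply: (le_trans (lerD h3 h2)); move: h4; move: (N.+1%:R^-1 : R) => z; lra.
Qed.

Section FixedScale.
Variables (rho lam : R).
Hypotheses (rho0 : 0 < rho) (lam1 : 1 <= lam).

Let lam0 : 0 < lam := lt_le_trans ltr01 lam1.

Lemma weight_gt0 al : 0 < weight rho lam al.
Proof.
by apply: mulr_gt0; [apply: mulr_gt0; first exact: multinomial_gt0|]; exact: exprn_gt0.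
Qed.

Lemma Phi_gt0 al : 0 < Phi rho lam al.
Proof. by rewrite divr_gt0 ?weight_gt0 ?exprn_gt0 ?ltr0n. Qed.

Lemma Psi_gt0 al : 0 < Psi rho lam al.
Proof. by rewrite divr_gt0 ?weight_gt0 ?ltr0n. Qed.

Lemma Phi_le_Psi al : Phi rho lam al <= Psi rho lam al.
Proof.
rewrite /Phi /Psi ler_pM2l ?weight_gt0 // lef_pV2 ?posrE ?exprn_gt0 ?ltr0n //.
by rewrite expr2 ler_peMr ?ler1n.
Qed.

Lemma Psi_le_weight al : Psi rho lam al <= weight rho lam al.
Proof.
by rewrite /Psi ler_pdivrMr ?ltr0n // ler_peMr ?ler1n // ltW ?weight_gt0.
Qed.

Lemma weight_le_pow al : weight rho lam al <= (n%:R * lam * rho) ^+ mdegree al.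
Proof.
rewrite /weight !exprMn ler_pM2r ?exprn_gt0 //; apply: ler_pM.
- exact: ltW (multinomial_gt0 _ _).
- by rewrite exprn_ge0 // ltW.
- exact: multinomial_le.
- by apply: ler_weXn2l => //; exact: leq_mdegree.
Qed.

(** Weights grow at most like B^|al| with B = n lam rho; at radius 1/(2B) the terms are below |A|
    2^(-|al|), and over a box these powers of 1/2 sum to a product of n geometric sums, each at most
    2. *)
Lemma abs_bounded_weight a (A : R) : (forall al, `|a al| <= A * weight rho lam al) ->
  exists2 r, 0 < r & abs_bounded (fun al => a al * r ^+ mdegree al).
Proof.
move=> Ha; pose B := n%:R * lam * rho.
have n0 : (0 < n)%N := leq_ltn_trans (leq0n i0) (ltn_ord i0).
have B0 : 0 < B by rewrite !mulr_gt0 // ltr0n.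
have wB al : weight rho lam al <= B ^+ mdegree al := weight_le_pow al.
move: B B0 wB => B B0 wB.
exists (2 * B)^-1; first by rewrite invr_gt0 mulr_gt0.
apply: (@abs_bounded_le _ _ _ (fun al => A * (2^-1 : R) ^+ mdegree al)).
  move=> al; rewrite !normrM.
  have r0 : 0 < (2 * B)^-1 by rewrite invr_gt0 mulr_gt0.
  have h0 : 0 < (2 : R)^-1 by rewrite invr_gt0.
  rewrite (gtr0_norm (exprn_gt0 _ r0)) (gtr0_norm (exprn_gt0 _ h0)).
  have -> : (2 : R)^-1 = B * (2 * B)^-1 by field; rewrite gt_eqF.
  rewrite exprMn mulrA ler_pM2r ?exprn_gt0 //.
  apply: (le_trans (Ha al)).
  apply: (@le_trans _ _ (`|A| * weight rho lam al)).
    by rewrite ler_pM2r ?weight_gt0 // ler_norm.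
  by apply: ler_wpM2l.
apply: abs_boundedZ; exists (\prod_(i < n) 2) => C.
have [N CN] := mbox_cofinal C.
apply: (le_trans (ler_fsum_sub CN _)) => //.
rewrite /fsum (eq_bigr (fun al => \prod_i (2^-1 : R) ^+ al i)); last first.
  by move=> al _; rewrite ger0_norm ?exprn_ge0 ?invr_ge0 // /mdegree expr_sum.
rewrite (@sum_mbox_prod n R (fun _ k => 2^-1 ^+ k)).
apply: ler_prod => i _; rewrite sumr_ge0 /=; last first.
  by move=> k _; rewrite exprn_ge0 ?invr_ge0.
elim: N {CN} => [|N IH]; first by rewrite big_ord0.
by rewrite big_ord_recl expr0; under eq_bigr do rewrite exprS; rewrite -big_distrr /=; lra.
Qed.

(** The powers of lam and rho multiply exactly, Vandermonde's identity absorbs the multinomials, and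
    [conv_weights] remains. With absolute values inside the sum, the bound also covers the truncated
    product [mconv0]. *)
Lemma mconv_majorant a b (A B : R) al : 0 <= A -> 0 <= B ->
  (forall be, `|a be| <= A * Phi rho lam be) ->
  (forall be, `|b be| <= B * Psi rho lam be) ->
  \sum_(be <- mbelow al) `|a be * b (msub al be)| <= 4 * A * B * Psi rho lam al.
Proof.
move=> A0 B0 Ha Hb; set N := mdegree al.
apply: (@le_trans _ _ (\sum_(be <- mbelow al) A * B * (weight rho lam al *
    (mbinomial R al be * ('C(N, mdegree be)%:R^-1 *
      ((mdegree be).+1%:R ^- 2 / (N - mdegree be).+1%:R)))))).
  rewrite big_seq [X in _ <= X]big_seq; apply: ler_sum => be.
  rewrite in_mbelow => bal; rewrite normrM.
  apply: (le_trans (ler_pM _ _ (Ha be) (Hb (msub al be)))) => //.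
  rewrite mulrACA; apply: ler_wpM2l; first exact: mulr_ge0.
  rewrite /Phi /Psi (mdegreeB bal) -/N /weight (mdegreeB bal) -/N.
  have hN : (mdegree be <= N)%N := mle_mdegree bal.
  have -> : lam ^+ al i0 = lam ^+ be i0 * lam ^+ (al i0 - be i0).
    by rewrite -exprD subnKC //; exact/mleP.
  have -> : rho ^+ N = rho ^+ mdegree be * rho ^+ (N - mdegree be).
    by rewrite -exprD subnKC.
  rewrite ffunE.
  rewrite le_eqVlt; apply/orP; left; apply/eqP.
  set u := lam ^+ _; set v := lam ^+ _; set w := rho ^+ _; set z := rho ^+ _.
  transitivity ((multinomial R be * multinomial R (msub al be)) * (u * v * (w * z) *
     ((mdegree be).+1%:R ^- 2 / (N - mdegree be).+1%:R))).
    move: (((mdegree be).+1%:R ^+ 2)^-1 : R) ((N - mdegree be).+1%:R^-1 : R) => e e'.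
    by ring.
  rewrite (multinomial_mbinomial R bal) -/N.
  move: (((mdegree be).+1%:R ^+ 2)^-1 : R) ((N - mdegree be).+1%:R^-1 : R) => e e'.
  by move: ('C(N, mdegree be)%:R^-1 : R) => c; ring.
rewrite -big_distrr -big_distrr /=.
rewrite (@sum_mbinomial_degree R n al (fun p => 'C(N, p)%:R^-1 *
  (p.+1%:R ^- 2 / (N - p).+1%:R))).
rewrite (eq_bigr (fun p : 'I_N.+1 => p.+1%:R ^- 2 / (N - p).+1%:R)); last first.
  by move=> p _ /=; rewrite -/N mulVKf // pnatr_eq0 -lt0n bin_gt0 -ltnS ltn_ord.
have -> : 4 * A * B * Psi rho lam al = A * B * (weight rho lam al * (4 / N.+1%:R)).
  by rewrite /Psi -/N; ring.
apply: ler_wpM2l; first exact: mulr_ge0.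
by apply: ler_wpM2l; [exact: ltW (weight_gt0 al)|exact: conv_weights].
Qed.

(** By [multinomial_munit], the degree factor becomes x/(x+1)^2 <= 1/x with x = |al| + 1; no power
    of lam is gained as i differs from [i0]. *)
Lemma pderiv_majorant a (A : R) i al : 0 <= A -> i != i0 ->
  (forall be, `|a be| <= A * Phi rho lam be) ->
  `|pderiv i a al| <= A * rho * Psi rho lam al.
Proof.
move=> A0 ii0 Ha; rewrite /pderiv normrM ger0_norm ?ler0n //.
apply: (le_trans (ler_wpM2l _ (Ha _))); first by rewrite ler0n.
rewrite mulrCA -mulrA; apply: ler_wpM2l => //.
rewrite /Phi /Psi /weight mdegreeD mdegree_unit add1n !ffunE eq_sym (negbTE ii0) add0n.
have := multinomial_gt0 R al; move: (multinomial_munit R al i).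
move: (multinomial R (madd (munit i) al)) (multinomial R al) => M' M E M0.
rewrite !mulrA E exprS.
have d0 : 0 < (mdegree al).+1%:R :> R by rewrite ltr0n.
have -> : (mdegree al).+2%:R = (mdegree al).+1%:R + 1 :> R by rewrite -natr1.
move: d0; move: ((mdegree al).+1%:R : R) => x x0.
have W0 : 0 < M * lam ^+ al i0 * rho ^+ mdegree al by rewrite !mulr_gt0 ?exprn_gt0.
rewrite [X in X <= _](_ : _ = rho * (M * lam ^+ al i0 * rho ^+ mdegree al)
  * (x / (x + 1) ^+ 2)); last by ring.
rewrite [X in _ <= X](_ : _ = rho * (M * lam ^+ al i0 * rho ^+ mdegree al) * x^-1);
  last by ring.
have x1 : 0 < x + 1 by lra.
rewrite ler_pM2l ?(mulr_gt0 rho0 W0) // ler_pdivrMr ?exprn_gt0 //.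
by rewrite ler_pdivlMl //; nra.
Qed.

(** Here x is the coefficient of a primitive along the stretched coordinate. The 4 comes from
    (y+1)^2 <= 4 y^2 for y = |al| + 1 >= 1. *)
Lemma time_primitive_majorant (B x : R) al :
  `|(al i0).+1%:R * x| <= B * Psi rho lam al ->
  `|x| <= 4 * B / (lam * rho) * Phi rho lam (madd (munit i0) al).
Proof.
have t0 : 0 < (al i0).+1%:R :> R by rewrite ltr0n.
have d0 : 1 <= (mdegree al).+1%:R :> R by rewrite ler1n.
have B0 : `|(al i0).+1%:R * x| <= B * Psi rho lam al -> 0 <= B.
  by move=> h; rewrite -(pmulr_lge0 _ (Psi_gt0 al)); apply: le_trans h.
move=> h; have {}B0 := B0 h; move: h; rewrite normrM gtr0_norm // => h.
rewrite -(ler_pM2l t0); apply: (le_trans h).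
rewrite /Phi /weight mdegreeD mdegree_unit add1n !ffunE eqxx add1n (exprS lam) (exprS rho).
rewrite /Psi /weight.
have := multinomial_gt0 R al; move: (multinomial_munit R al i0).
move: (multinomial R (madd (munit i0) al)) (multinomial R al) => M' M E M0.
have -> : (al i0).+1%:R * (4 * B / (lam * rho) * (M' *
   (lam * lam ^+ al i0) * (rho * rho ^+ mdegree al) / (mdegree al).+2%:R ^+ 2)) =
  (al i0).+1%:R * M' *
  (4 * B / (lam * rho) * ((lam * lam ^+ al i0) * (rho * rho ^+ mdegree al) /
   (mdegree al).+2%:R ^+ 2)) by ring.
rewrite E.
have -> : (mdegree al).+2%:R = (mdegree al).+1%:R + 1 :> R by rewrite -natr1.
have W0 : 0 < M * lam ^+ al i0 * rho ^+ mdegree al by rewrite !mulr_gt0 ?exprn_gt0.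
move: d0; move: ((mdegree al).+1%:R : R) => y y1.
rewrite [X in _ <= X](_ : _ = B * ((M * lam ^+ al i0 * rho ^+ mdegree al)
  * (4 * y / (y + 1) ^+ 2))); last by field; rewrite !gt_eqF //; lra.
apply: ler_wpM2l => //; apply: ler_wpM2l; first exact: ltW.
have y0 : 0 < y by lra.
have y10 : 0 < (y + 1) ^+ 2 by rewrite exprn_gt0 //; lra.
by rewrite ler_pdivlMr // ler_pdivrMl //; nra.
Qed.

(** The 4 pays for the denominator, as (k+1)^2 <= 4^k; the multinomial and the power of lam are at
    least 1. *)
Lemma pow_le_Phi al : (rho / 4) ^+ mdegree al <= Phi rho lam al.
Proof.
rewrite /Phi ler_pdivlMr ?exprn_gt0 ?ltr0n //.
apply: (@le_trans _ _ ((rho / 4) ^+ mdegree al * 4 ^+ mdegree al)).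
  apply: ler_wpM2l; first by rewrite exprn_ge0 // divr_ge0 // ltW.
  have -> : (4 : R) = 2 ^+ 2 by rewrite expr2; lra.
  rewrite -exprM mulnC exprM; apply: lerXn2r; rewrite ?nnegrE ?exprn_ge0 //.
  by rewrite -natrX ler_nat; apply: ltn_expl.
rewrite -exprMn divfK // /weight ler_peMl ?exprn_ge0 ?(ltW rho0) //.
by rewrite mulr_ege1 ?multinomial_ge1 // exprn_ege1.
Qed.

End FixedScale.

Definition geometric_bound a (C s : R) : Prop :=
  [/\ 0 <= C, 0 < s & forall al, `|a al| <= C * s ^+ mdegree al].

Definition geometric a : Prop := exists C s, geometric_bound a C s.

Lemma geometric_majorant a (C s : R) : geometric_bound a C s ->
  \forall rho \near +oo, forall lam, 1 <= lam -> forall al, `|a al| <= C * Phi rho lam al.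
Proof.
move=> [C0 s0 H]; near=> rho => lam lam1 al.
have hr : 4 * s <= rho by near: rho; apply: nbhs_pinfty_ge; rewrite num_real.
have rho0 : 0 < rho by apply: lt_le_trans hr; rewrite mulr_gt0.
apply: (le_trans (H al)); apply: ler_wpM2l => //.
apply: le_trans (pow_le_Phi rho0 lam1 al).
apply: lerXn2r; rewrite ?nnegrE ?(ltW s0) //; first by rewrite divr_ge0 ?ltW.
by rewrite ler_pdivlMr // mulrC.
Unshelve. all: by end_near. Qed.

Lemma geometric_majorant_small a (C s eps : R) : geometric_bound a C s ->
  a (mzero n) = 0 -> 0 < eps ->
  \forall rho \near +oo, forall lam, 1 <= lam -> forall al, `|a al| <= eps * Phi rho lam al.
Proof.
move=> [C0 s0 H] a0 e0; near=> rho => lam lam1 al.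
(* d <= 1 gives d^k <= d for k > 0, and C d <= eps. A coefficient of degree k > 0 thus gains the
   factor d from a large rho; the one of degree 0 vanishes. *)
pose d := Num.min 1 (eps / (C + 1)).
have C1 : 0 < C + 1 by lra.
have d0 : 0 < d by rewrite lt_min ltr01 divr_gt0.
have hr : 4 * s / d <= rho by near: rho; apply: nbhs_pinfty_ge; rewrite num_real.
have rho0 : 0 < rho by apply: lt_le_trans hr; rewrite divr_gt0 ?mulr_gt0.
have hs : s <= d * (rho / 4) by move: hr; rewrite ler_pdivrMr //; lra.
apply: (@le_trans _ _ (eps * (rho / 4) ^+ mdegree al)); last first.
  by apply: ler_wpM2l (pow_le_Phi rho0 lam1 al); exact: ltW.
have [->|al0] := eqVneq al (mzero n).
  by rewrite a0 normr0 mulr_ge0 ?exprn_ge0 ?divr_ge0 ?ltW.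
apply: (le_trans (H al)).
have r4 : 0 <= rho / 4 by rewrite divr_ge0 ?ltW.
have hk : s ^+ mdegree al <= d * (rho / 4) ^+ mdegree al.
  case E : (mdegree al) => [|k]; first by rewrite -mdegree_eq0 E in al0.
  apply: (@le_trans _ _ ((d * (rho / 4)) ^+ k.+1)).
    by apply: lerXn2r; rewrite ?nnegrE ?mulr_ge0 ?(ltW s0) ?(ltW d0).
  rewrite exprMn exprS; apply: ler_wpM2r; first by rewrite exprn_ge0.
  by rewrite ler_piMr ?(ltW d0) // exprn_ile1 ?(ltW d0) // ge_min lexx.
apply: (le_trans (ler_wpM2l C0 hk)); rewrite mulrA; apply: ler_wpM2r.
  by rewrite exprn_ge0.
apply: (@le_trans _ _ (C * (eps / (C + 1)))).
  by apply: ler_wpM2l => //; rewrite ge_min lexx orbT.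
by rewrite mulrA ler_pdivrMr // mulrC ler_pM2l //; lra.
Unshelve. all: by end_near. Qed.

End Weights.

Lemma has_ps_geometric (R : realType) n a (f : 'rV[R]_n -> R) p : has_ps a f p ->
  geometric a.
Proof.
move=> [r [r0 /abs_bounded_single[C C0 H] _]]; exists C, r^-1; split=> [//||al].
  by rewrite invr_gt0.
have := H al; rewrite normrM (gtr0_norm (exprn_gt0 _ r0)).
by rewrite exprVn -ler_pdivlMr ?exprn_gt0.
Qed.

(** * The formal Codazzi system *)

Section Indices.
Variable m : nat.
Local Notation I := 'I_m.+1.
Implicit Types (a b c i j : I).

Definition lower i j : I := if (i <= j)%N then i else j.
Definition upper i j : I := if (i <= j)%N then j else i.

Lemma lowerC i j : lower i j = lower j i.
Proof. by rewrite /lower; case: ltngtP => // /val_inj ->. Qed.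

Lemma upperC i j : upper i j = upper j i.
Proof. by rewrite /upper; case: ltngtP => // /val_inj ->. Qed.

Lemma lower_le_upper i j : (lower i j <= upper i j)%N.
Proof. by rewrite /lower /upper; case: (leqP i j) => //; exact: ltnW. Qed.

Lemma lower_id i j : (i <= j)%N -> lower i j = i.
Proof. by rewrite /lower => ->. Qed.

Lemma upper_id i j : (i <= j)%N -> upper i j = j.
Proof. by rewrite /upper => ->. Qed.

(* [spatial b c] is the smallest nonzero one of [b] and [c], when there is one. *)
Definition spatial b c : I := if lower b c == ord0 then upper b c else lower b c.
Definition cospatial b c : I := if lower b c == ord0 then lower b c else upper b c.

Lemma spatialC b c : spatial b c = spatial c b.
Proof. by rewrite /spatial lowerC upperC. Qed.

Lemma cospatialC b c : cospatial b c = cospatial c b.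
Proof. by rewrite /cospatial lowerC upperC. Qed.

(* [Gamma^a_{bc}] is solved for, in terms of [Gamma^s_{ao}] with
   [s = spatial b c] and [o = cospatial b c]; all the others are free. *)
Definition dependent a b c : bool := (0 < spatial b c)%N && (spatial b c < a)%N.

Lemma dependentC a b c : dependent a b c = dependent a c b.
Proof. by rewrite /dependent spatialC. Qed.

Lemma spatial_cases b c :
  (spatial b c = b /\ cospatial b c = c) \/ (spatial b c = c /\ cospatial b c = b).
Proof.
rewrite /spatial /cospatial /lower /upper; case: leqP => h; case: eqP => e;
  by [left|right].
Qed.

Lemma spatial_id (s o : I) : (o == ord0) || (s <= o)%N -> (0 < s)%N ->
  spatial s o = s /\ cospatial s o = o.
Proof.
move=> h s0; have sn : (s == ord0) = false by apply/eqP => e; rewrite e in s0.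
case/orP: h => [/eqP ->|so]; rewrite /spatial /cospatial.
  by rewrite lowerC upperC /lower /upper leq0n eqxx.
by rewrite lower_id // upper_id // sn.
Qed.

(** The smallest nonzero index among a and o is at least s. Hence the equation giving Gamma^a_so has
    the free symbol Gamma^s_ao as its other term of order zero in v, and no elimination among
    dependent symbols arises. *)
Lemma dependent_swap a b c : dependent a b c ->
  ~~ dependent (spatial b c) a (cospatial b c).
Proof.
rewrite /dependent => /andP[s0 sa]; rewrite negb_and; apply/orP; right; rewrite -leqNgt.
have so : (cospatial b c == ord0) || (spatial b c <= cospatial b c)%N.
  rewrite /spatial /cospatial; case: (boolP (lower b c == ord0)) => [->//|_].
  by rewrite lower_le_upper orbT.
have a0 : (a == ord0) = false by apply/eqP => e; rewrite e in sa.
move: (spatial b c) (cospatial b c) s0 sa so => s o s0 sa so.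
case/orP: so => [/eqP ->|so]; rewrite /spatial.
  rewrite lowerC upperC /lower /upper leq0n eqxx; exact: ltnW.
by rewrite /lower /upper; case: (leqP a o) => h; case: ifP => _ //; exact: ltnW.
Qed.

Definition free_christoffel : {set I * I * I} :=
  [set t in christoffel_indices m | ~~ dependent t.1.1 t.1.2 t.2].

Lemma free_lower_upper a b c : ~~ dependent a b c ->
  (a, lower b c, upper b c) \in free_christoffel.
Proof.
move=> h; rewrite !inE /= lower_le_upper /=; apply: contra h.
by rewrite /dependent /spatial (lower_id (lower_le_upper b c))
  (upper_id (lower_le_upper b c)).
Qed.

End Indices.

Section FormalSystem.
Variables (R : realType) (m : nat).
Local Notation n := m.+1.
Local Notation I := 'I_n.
Local Notation mindex := (mindex n).
Local Notation series := (mindex -> R).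

Variables (F : series) (gm : I * I * I -> series) (H : I * I -> series).
Implicit Types (v : I -> I -> series) (G : I -> I -> I -> series) (al be ga : mindex).

(** Dropping the term be = 0 is harmless when a vanishes at 0, and it frees the coefficient at al
    from that of b at al, as the recursion requires. *)
Definition mconv0 (a b : series) : series := fun al =>
  \sum_(be <- mbelow al | be != mzero n) a be * b (msub al be).

Lemma mconv_mconv0 (a b : series) : a (mzero n) = 0 -> mconv a b =1 mconv0 a b.
Proof.
move=> a0 al; rewrite /mconv /mconv0 /fsum big_mkcond [RHS]big_mkcond /=.
by apply: eq_bigr => be _; case: eqP => // ->; rewrite a0 mul0r.
Qed.

Definition quad v G i k j : series := fun al => \sum_l mconv0 (v i l) (G l k j) al.

(* The coefficients of [g(d_i, nabla_{d_k} d_j)] when [g = 1 + v]. *)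
Definition lowered v G i k j : series := fun al => G i k j al + quad v G i k j al.

Definition codazzi_defect v G k i j : series := fun al =>
  pderiv k (v i j) al - pderiv i (v k j) al - lowered v G i k j al
  + lowered v G k i j al.

Record formal_solution v G : Prop := {
  fs_symv : forall i j, v i j = v j i;
  fs_symG : forall k i j, G k i j = G k j i;
  fs_F : v ord0 ord0 = F;
  fs_init : forall t, t \in metric_indices m ->
    forall al, al ord0 = 0%N -> v t.1 t.2 al = H t al;
  fs_free : forall t, t \in free_christoffel m -> G t.1.1 t.1.2 t.2 = gm t;
  fs_codazzi : forall k i j al, codazzi_defect v G k i j al = 0 }.

(** The three cases are g_11, the initial values on x^1 = 0, and integration along x^1 of the
    equation (0, h, l), indices being numbered from 0. *)
Definition step_metric v G i j : series := fun al =>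
  let l := lower i j in let h := upper i j in
  if h == ord0 then F al else
  if al ord0 == 0%N then H (l, h) al else
  let be := msub al (munit ord0) in
  (al ord0)%:R^-1 * (pderiv h (v ord0 l) be + lowered v G h ord0 l be
                     - lowered v G ord0 h l be).

(** For a dependent symbol, the equation (s, a, o) is solved for Gamma^a_so. The partner Gamma^s_ao
    is read in [gm] rather than in [G], so that [G] enters only through [quad]. *)
Definition step_christoffel v G a b c : series := fun al =>
  if dependent a b c then
    let s := spatial b c in let o := cospatial b c in
    gm (s, lower a o, upper a o) al + quad v G s a o al - quad v G a s o al
    + pderiv s (v a o) al - pderiv a (v s o) al
  else gm (a, lower b c, upper b c) al.

Definition fixpoint v G : Prop :=
  step_metric v G = v /\ step_christoffel v G = G.

Lemma codazzi_defectC v G k i j al :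
  codazzi_defect v G i k j al = - codazzi_defect v G k i j al.
Proof. rewrite /codazzi_defect; ring. Qed.

Lemma codazzi_defect_cyclic v G : (forall i j, v i j = v j i) ->
  (forall k i j, G k i j = G k j i) -> forall k i j al,
  codazzi_defect v G k i j al + codazzi_defect v G i j k al
    + codazzi_defect v G j k i al = 0.
Proof.
move=> sv sG k i j al; rewrite /codazzi_defect.
have sL a b c : lowered v G a b c = lowered v G a c b.
  apply/funext => z; rewrite /lowered /quad (sG _ b c); congr (_ + _).
  by apply: eq_bigr => l _; rewrite (sG _ b c).
rewrite (sv j i) (sv k i) (sv k j) (sL i k j) (sL k i j) (sL j k i); ring.
Qed.

Hypotheses (F0 : F (mzero n) = 0)
  (H0 : forall t, t \in metric_indices m -> H t (mzero n) = 0).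

Lemma metric_indices_lower_upper i j : upper i j != ord0 ->
  (lower i j, upper i j) \in metric_indices m.
Proof.
move=> h; rewrite inE /= lower_le_upper /=; apply: contra h => /eqP[_ ->].
by [].
Qed.

Section FixedPoint.
Variables (v : I -> I -> series) (G : I -> I -> I -> series).
Hypothesis fix_vG : fixpoint v G.

Lemma fixpoint_symv i j : v i j = v j i.
Proof.
by case: fix_vG => <- _; apply/funext => al; rewrite /step_metric lowerC upperC.
Qed.

Lemma fixpoint_symG k i j : G k i j = G k j i.
Proof.
case: fix_vG => _ <-; apply/funext => al.
by rewrite /step_christoffel dependentC spatialC cospatialC (lowerC i j) (upperC i j).
Qed.

Lemma fixpoint_codazzi_time (i j : I) al : (i <= j)%N -> j != ord0 ->
  codazzi_defect v G ord0 j i al = 0.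
Proof.
move=> ij j0; rewrite /codazzi_defect.
have := congr1 (fun w => w j i (madd (munit ord0) al)) fix_vG.1.
rewrite /step_metric lowerC upperC lower_id // upper_id // (negbTE j0) maddK !ffunE eqxx /=.
rewrite /pderiv => <-; rewrite mulVKf ?pnatr_eq0 //; ring.
Qed.

Lemma fixpoint_codazzi_space (s a o : I) al : (0 < s)%N -> (s < a)%N ->
  (o == ord0) || (s <= o)%N -> codazzi_defect v G s a o al = 0.
Proof.
move=> s0 sa so; have [E1 E2] := spatial_id so s0.
have d : dependent a s o by rewrite /dependent E1 s0.
have := congr1 (fun w => w a s o al) fix_vG.2.
rewrite /step_christoffel d E1 E2 => E.
have := congr1 (fun w => w s (lower a o) (upper a o) al) fix_vG.2.
rewrite /step_christoffel.
have [sp cs] : spatial (lower a o) (upper a o) = spatial a o /\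
    lower (lower a o) (upper a o) = lower a o.
  by rewrite /spatial !(lower_id (lower_le_upper a o)) !(upper_id (lower_le_upper a o)).
have := dependent_swap d; rewrite E1 E2 => nd.
rewrite {1}/dependent sp -/(dependent s a o) (negbTE nd).
rewrite (lower_id (lower_le_upper a o)) (upper_id (lower_le_upper a o)) => E'.
have E3 : G s (lower a o) (upper a o) = G s a o.
  by rewrite /lower /upper; case: ifP => // _; rewrite fixpoint_symG.
rewrite /codazzi_defect /lowered -E E' E3; ring.
Qed.

Lemma fixpoint_codazzi k i j al : codazzi_defect v G k i j al = 0.
Proof.
have cyc := codazzi_defect_cyclic fixpoint_symv fixpoint_symG.
have antiC := codazzi_defectC v G.
wlog ki : k i / (k < i)%N.
  move=> W; case: (ltngtP k i) => [|ik|/val_inj ->]; first exact: W.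
    by rewrite antiC W ?oppr0.
  by rewrite /codazzi_defect; ring.
have i0 : i != ord0 by apply/eqP => e; rewrite e in ki.
case: (posnP k) => [k0|k0].
  have -> : k = ord0 by exact: val_inj.
  case: (leqP j i) => ji; first exact: fixpoint_codazzi_time.
  have j0 : j != ord0 by apply/eqP => e; rewrite e in ji.
  (* For i < j the cyclic companions are (i, j, 0), solved for a symbol, and (j, 0, i), the opposite
     of the equation solved for d_1 v_ij. *)
  have := cyc ord0 i j al.
  rewrite (@fixpoint_codazzi_space i j ord0) //.
    by rewrite (antiC ord0 j) (@fixpoint_codazzi_time i j) ?oppr0 ?addr0 ?(ltnW ji).
  by rewrite lt0n; apply: contra i0 => /eqP e; apply/eqP/val_inj.
case: (boolP ((j == ord0) || (k <= j)%N)) => [|].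
  exact: fixpoint_codazzi_space.
rewrite negb_or -ltnNge => /andP[j0 jk].
have jp : (0 < j)%N by rewrite lt0n; apply: contra j0 => /eqP e; apply/eqP/val_inj.
(* For 0 < j < k < i the companions are, up to sign, (j, i, k) and (j, k, i), both solved for a
   symbol. *)
have := cyc k i j al.
have ji := ltn_trans jk ki.
rewrite (antiC j i) (@fixpoint_codazzi_space j i k) ?(ltnW jk) ?orbT //.
by rewrite (@fixpoint_codazzi_space j k i) ?(ltnW ji) ?orbT // oppr0 !addr0.
Qed.

Lemma fixpoint_metric0 i j : v i j (mzero n) = 0.
Proof.
case: fix_vG => <- _; rewrite /step_metric ffunE eqxx.
case: ifP => // /negbT h; apply: H0; exact: metric_indices_lower_upper.
Qed.

Lemma fixpoint_solution : formal_solution v G.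
Proof.
split; [exact: fixpoint_symv|exact: fixpoint_symG| | | |exact: fixpoint_codazzi].
- by case: fix_vG => <- _; apply/funext => al; rewrite /step_metric upper_id ?eqxx.
- move=> [i j]; rewrite inE /= => /andP[ij t0] al al0.
  case: fix_vG => <- _; rewrite /step_metric lower_id // upper_id // al0 eqxx.
  case: eqP => // j0; move: t0 ij; rewrite j0 leqn0 => t0 /eqP i0.
  by case/eqP: t0; congr pair; apply: val_inj.
- move=> [[a b] c]; rewrite !inE /= => /andP[bc nd].
  case: fix_vG => _ <-; apply/funext => al; rewrite /step_christoffel (negbTE nd).
  by rewrite lower_id // upper_id.
Qed.

End FixedPoint.

(** Source of formal uniqueness: the step maps have a single fixed point. *)
Lemma solution_fixpoint v G : formal_solution v G -> fixpoint v G.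
Proof.
move=> [symv symG vF vinit Gfree cod].
have vE i j : v i j = v (lower i j) (upper i j).
  by rewrite /lower /upper; case: ifP => // _; rewrite symv.
have GE k i j : G k i j = G k (lower i j) (upper i j).
  by rewrite /lower /upper; case: ifP => // _; rewrite symG.
have gmE a b c : ~~ dependent a b c -> gm (a, lower b c, upper b c) = G a b c.
  by move=> nd; rewrite -(Gfree _ (free_lower_upper nd)) /= -GE.
split; apply/funext => i; apply/funext => j.
  apply/funext => al; rewrite /step_metric.
  case: ifPn => [/eqP u0|u0].
    have l0 : lower i j = ord0.
      by apply: val_inj; apply/eqP; rewrite -leqn0 -[X in (_ <= X)%N]/(val (@ord0 m)) -u0
        lower_le_upper.
    by rewrite vE l0 u0 vF.
  case: ifPn => [/eqP al0|al0].
    by rewrite vE -(vinit _ (metric_indices_lower_upper u0)).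
  have aE : madd (munit ord0) (msub al (munit ord0)) = al.
    by apply: msubK; rewrite mle_munit lt0n.
  have := cod ord0 (upper i j) (lower i j) (msub al (munit ord0)).
  have alS : al ord0 = (msub al (munit ord0) ord0).+1.
    by rewrite -[in LHS]aE !ffunE eqxx add1n.
  rewrite /codazzi_defect {1}/pderiv aE -alS symv -vE => E.
  have a0 : (al ord0)%:R != 0 :> R by rewrite pnatr_eq0.
  apply: (mulfI a0); rewrite mulVKf //.
  by apply/eqP; rewrite -subr_eq0 -oppr_eq0 -E; apply/eqP; ring.
apply/funext => c; apply/funext => al; rewrite /step_christoffel.
case: ifPn => d; last by rewrite gmE.
rewrite (gmE _ _ _ (dependent_swap d)).
have := cod (spatial j c) i (cospatial j c) al.
have -> : G i j c = G i (spatial j c) (cospatial j c).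
  by case: (spatial_cases j c) => -[-> ->] //; rewrite symG.
by rewrite /codazzi_defect /lowered => E; apply/eqP; rewrite -subr_eq0 -E; apply/eqP; ring.
Qed.

End FormalSystem.

(** * Formal solution by iteration, with its bounds *)

Section Solve.
Variables (R : realType) (m : nat).
Local Notation n := m.+1.
Local Notation I := 'I_n.
Local Notation mindex := (mindex n).
Local Notation series := (mindex -> R).
Variables (F : series) (gm : I * I * I -> series) (H : I * I -> series).
Implicit Types (v w : I -> I -> series) (G K : I -> I -> I -> series).
Implicit Types (al be ga : mindex).

Local Notation stepv := (step_metric F H).
Local Notation stepG := (step_christoffel gm).

(* With this rank, a coefficient of a step only involves coefficients of
   smaller rank, those of the Christoffel symbols having rank [rank al + 2]. *)
Definition rank al : nat := (mdegree al + 2 * al ord0)%N.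

Lemma rankD al be : rank (madd al be) = (rank al + rank be)%N.
Proof. by rewrite /rank mdegreeD ffunE; lia. Qed.

Lemma rank_munit (i : I) : i != ord0 -> rank (munit i) = 1%N.
Proof. by move=> /negbTE i0; rewrite /rank mdegree_unit ffunE eq_sym i0. Qed.

Lemma rank_munit0 : rank (munit ord0) = 3%N.
Proof. by rewrite /rank mdegree_unit ffunE eqxx. Qed.

Lemma rank_split al be : mle be al -> rank al = (rank be + rank (msub al be))%N.
Proof. by move=> h; rewrite -rankD msubK. Qed.

Lemma rank_gt0 al : al != mzero n -> (0 < rank al)%N.
Proof. by rewrite /rank -mdegree_eq0 -lt0n => h; rewrite ltn_addr. Qed.

Definition agree k v G w K : Prop :=
  (forall i j al, (rank al < k)%N -> v i j al = w i j al) /\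
  (forall a b c al, (rank al + 2 < k)%N -> G a b c al = K a b c al).

Lemma mconv0_agree (a a' b b' : series) al :
  (forall be, mle be al -> a be = a' be) ->
  (forall be, mle be al -> be != mzero n -> b (msub al be) = b' (msub al be)) ->
  mconv0 a b al = mconv0 a' b' al.
Proof.
move=> ha hb; rewrite /mconv0 big_seq_cond [RHS]big_seq_cond; apply: eq_bigr => be.
by rewrite in_mbelow => /andP[h1 h2]; rewrite ha // hb.
Qed.

Lemma quad_agree k v G w K al i p q : agree k v G w K -> (rank al + 2 <= k)%N ->
  quad v G i p q al = quad w K i p q al.
Proof.
move=> [hv hG] rk; apply: eq_bigr => l _; apply: mconv0_agree => be bal.
  by apply: hv; have := rank_split bal; lia.
by move=> /rank_gt0 b0; apply: hG; have := rank_split bal; lia.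
Qed.

(** Along x^1 a derivative raises the rank by 3, along another axis by 1. So v at rank r uses Gamma
    at rank r - 3 at most, counted r - 1 with the shift by 2, and v at rank r - 2 at most; Gamma,
    counted r + 2, uses v at rank r + 1 at most. In products, be nonzero puts Gamma at a smaller
    rank. *)
Lemma step_agree k v G w K : agree k v G w K ->
  agree k.+1 (stepv v G) (stepG v G) (stepv w K) (stepG w K).
Proof.
move=> ag; have [hv hG] := ag; split=> [i j al rk|a b c al rk].
  rewrite /step_metric; case: ifPn => // u0; case: ifPn => // al0.
  have bal : mle (munit ord0) al by rewrite mle_munit lt0n.
  have := rank_split bal; rewrite rank_munit0 => rb.
  set be := msub al (munit ord0) in rb *.
  have low p q r : lowered v G p q r be = lowered w K p q r be.
    by rewrite /lowered (quad_agree _ _ _ ag) ?hG //; lia.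
  by rewrite !low /pderiv hv // rankD rank_munit //; lia.
rewrite /step_christoffel; case: ifPn => // /andP[s0 sa].
have s1 : spatial b c != ord0 by apply/eqP => e; rewrite e in s0.
have a1 : a != ord0 by apply/eqP => e; rewrite e in sa.
rewrite !(quad_agree _ _ _ ag); [|lia|lia].
by rewrite /pderiv !hv //; rewrite rankD rank_munit //; lia.
Qed.

Lemma fixpoint_unique v G w K : fixpoint F gm H v G -> fixpoint F gm H w K ->
  v = w /\ G = K.
Proof.
move=> [fv fG] [fw fK].
have ag k : agree k v G w K.
  elim: k => [|k IH]; first by split.
  by have := step_agree IH; rewrite fv fG fw fK.
split; apply/funext => i; apply/funext => j.
  by apply/funext => al; exact: (ag (rank al).+1).1.
by apply/funext => l; apply/funext => al; apply: (ag (rank al + 2).+1).2.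
Qed.

Fixpoint iterates k : (I -> I -> series) * (I -> I -> I -> series) :=
  if k is k'.+1 then
    let vG := iterates k' in (stepv vG.1 vG.2, stepG vG.1 vG.2)
  else (fun _ _ _ => 0, fun _ _ _ _ => 0).

(** The iterate of index rank + 1 is read because [agree k] controls the ranks below k: the
    coefficient no longer changes afterwards. *)
Definition limit_metric i j : series := fun al => (iterates (rank al).+1).1 i j al.
Definition limit_christoffel a b c : series :=
  fun al => (iterates (rank al + 2).+1).2 a b c al.

Lemma iterates_agree k l : (k <= l)%N ->
  agree k (iterates k).1 (iterates k).2 (iterates l).1 (iterates l).2.
Proof.
elim: k l => [|k IH] [|l] // kl; exact: step_agree (IH _ kl).
Qed.

Lemma limit_agree k :
  agree k (iterates k).1 (iterates k).2 limit_metric limit_christoffel.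
Proof.
split=> [i j al rk|a b c al rk]; apply/esym.
  by apply: (iterates_agree rk).1.
by apply: (iterates_agree rk).2.
Qed.

Lemma limit_fixpoint : fixpoint F gm H limit_metric limit_christoffel.
Proof.
have ag k : agree k (stepv limit_metric limit_christoffel)
    (stepG limit_metric limit_christoffel) limit_metric limit_christoffel.
  case: k => [|k]; first by split.
  have [h1 h2] := step_agree (limit_agree k); have [h3 h4] := limit_agree k.+1.
  split=> [i j al rk|a b c al rk]; first by rewrite -h3 // -h1.
  by rewrite -h4 // -h2.
split; apply/funext => i; apply/funext => j.
  by apply/funext => al; exact: (ag (rank al).+1).1.
by apply/funext => l; apply/funext => al; apply: (ag (rank al + 2).+1).2.
Qed.

Section Bounds.
Variables (rho lam eps K0 : R).
Hypotheses (rho0 : 0 < rho) (lam1 : 1 <= lam) (eps0 : 0 < eps) (K00 : 0 <= K0).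
Local Notation Phi := (Phi (ord0 : I) rho lam).
Local Notation Psi := (Psi (ord0 : I) rho lam).
(** A Christoffel step is bounded by K0 + C/4 + C/4 + 2 eps rho, for a datum, two products and two
    derivatives, and C makes this sum equal to C. The condition [epsn] turns n products of size 4
    eps C into C/4; [lamC] brings a primitive of a function of size eps rho + 4 C back below eps. *)
Let C := 2 * (K0 + 2 * eps * rho).
Hypotheses (epsn : 16 * n%:R * eps <= 1)
  (lamC : 4 * (eps * rho + 4 * C) <= eps * (lam * rho)).
Hypotheses (HF : forall al, `|F al| <= eps * Phi al)
  (HH : forall t, t \in metric_indices m -> forall al, `|H t al| <= eps * Phi al)
  (Hgm : forall t, t \in free_christoffel m -> forall al, `|gm t al| <= K0 * Psi al).

Definition bounded_by v G : Prop :=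
  (forall i j al, `|v i j al| <= eps * Phi al) /\
  (forall a b c al, `|G a b c al| <= C * Psi al).

Let C0 : 0 <= C.
Proof. by rewrite mulr_ge0 // addr_ge0 // !mulr_ge0 // ltW. Qed.

Lemma quad_bound v G i k j al : bounded_by v G ->
  `|quad v G i k j al| <= C / 4 * Psi al.
Proof.
move=> [bv bG]; have P0 := Psi_gt0 (ord0 : I) rho0 lam1 al.
apply: (le_trans (ler_norm_sum _ _ _)).
apply: (@le_trans _ _ (\sum_(l < n) 4 * eps * C * Psi al)).
  apply: ler_sum => l _.
  apply: le_trans (mconv_majorant rho0 lam1 al (ltW eps0) C0 (bv i l) (bG l k j)).
  apply: (le_trans (ler_norm_sum _ _ _)); rewrite big_mkcond; apply: ler_sum => be _.
  by case: ifP.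
rewrite sumr_const card_ord -(mulr_natr _ n) [X in X <= _]mulrAC; apply: ler_wpM2r; first exact: ltW.
have := ler_wpM2l C0 epsn; move: (n%:R : R) C => N c; lra.
Qed.

Lemma lowered_bound v G i k j al : bounded_by v G ->
  `|lowered v G i k j al| <= 2 * C * Psi al.
Proof.
move=> bvG; apply: (le_trans (ler_normD _ _)).
have := quad_bound i k j al bvG; have := bvG.2 i k j al.
have P0 := Psi_gt0 (ord0 : I) rho0 lam1 al; have := mulr_ge0 C0 (ltW P0); lra.
Qed.

Lemma step_bound v G : bounded_by v G -> bounded_by (stepv v G) (stepG v G).
Proof.
move=> bvG; have [bv bG] := bvG; split=> [i j al|a b c al].
  rewrite /step_metric; case: ifPn => // u0; case: ifPn => [_|al0].
    by apply: HH; exact: metric_indices_lower_upper.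
  have bal : mle (munit ord0) al by rewrite mle_munit lt0n.
  have aE := msubK bal; set be := msub al (munit ord0) in aE *.
  have alS : al ord0 = (be ord0).+1 by rewrite -[in LHS]aE !ffunE eqxx add1n.
  rewrite -[in X in _ <= X]aE.
  set x := _^-1 * _.
  have hx : `|(be ord0).+1%:R * x| <= (eps * rho + 4 * C) * Psi be.
    rewrite /x alS mulVKf ?pnatr_eq0 //.
    have h1 := pderiv_majorant rho0 lam1 be (ltW eps0) u0 (bv ord0 (lower i j)).
    have h2 := lowered_bound (upper i j) ord0 (lower i j) be bvG.
    have h3 := lowered_bound ord0 (upper i j) (lower i j) be bvG.
    apply: (le_trans (ler_normB _ _)); apply: (le_trans (lerD (ler_normD _ _) (lexx _))).
    by apply: (le_trans (lerD (lerD h1 h2) h3)); lra.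
  apply: (le_trans (time_primitive_majorant rho0 lam1 hx)).
  apply: ler_wpM2r; first exact: ltW (Phi_gt0 _ rho0 lam1 _).
  rewrite ler_pdivrMr // mulr_gt0 //; exact: lt_le_trans lam1.
have P0 := Psi_gt0 (ord0 : I) rho0 lam1 al.
rewrite /step_christoffel; case: ifPn => d; last first.
  apply: (le_trans (Hgm (free_lower_upper d) al)); apply: ler_wpM2r; first exact: ltW.
  by rewrite /C; have := mulr_ge0 (ltW eps0) (ltW rho0); move: K00; lra.
have /andP[s0 sa] := d.
have s1 : spatial b c != ord0 by apply/eqP => e; rewrite e in s0.
have a1 : a != ord0 by apply/eqP => e; rewrite e in sa.
have h1 := Hgm (free_lower_upper (dependent_swap d)) al.
have h2 := quad_bound (spatial b c) a (cospatial b c) al bvG.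
have h3 := quad_bound a (spatial b c) (cospatial b c) al bvG.
have h4 := pderiv_majorant rho0 lam1 al (ltW eps0) s1 (bv a (cospatial b c)).
have h5 := pderiv_majorant rho0 lam1 al (ltW eps0) a1 (bv (spatial b c) (cospatial b c)).
apply: (le_trans (ler_normB _ _)).
apply: (le_trans (lerD (ler_normD _ _) (lexx _))).
apply: (le_trans (lerD (lerD (ler_normB _ _) (lexx _)) (lexx _))).
apply: (le_trans (lerD (lerD (lerD (ler_normD _ _) (lexx _)) (lexx _)) (lexx _))).
apply: (le_trans (lerD (lerD (lerD (lerD h1 h2) h3) h4) h5)).
by rewrite -!mulrDl; apply: ler_wpM2r; [exact: ltW|rewrite /C; lra].
Qed.

(** Each coefficient of the limit is a coefficient of some iterate. *)
Lemma limit_bound : bounded_by limit_metric limit_christoffel.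
Proof.
have it k : bounded_by (iterates k).1 (iterates k).2.
  elim: k => [|k IH]; last exact: step_bound.
  split=> [i j al|a b c al] /=; rewrite normr0 mulr_ge0 //.
  - exact: ltW.
  - exact: ltW (Phi_gt0 _ rho0 lam1 _).
  - exact: ltW (Psi_gt0 _ rho0 lam1 _).
by split=> [i j al|a b c al]; [apply: (it _).1|apply: (it _).2].
Qed.

End Bounds.
End Solve.

(** * Counting the parameters *)

Section Counting.
Local Open Scope nat_scope.

Lemma count_leq x n : x < n -> \sum_(a < n) (a <= x) = x.+1.
Proof.
elim: n => // n IH; rewrite big_ord_recr /= ltnS leq_eqVlt => /orP[/eqP ->|xn].
  rewrite leqnn (eq_bigr (fun _ => 1)); first by rewrite sum1_card card_ord addn1.
  by move=> i _; rewrite ltnW.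
by rewrite IH // leqNgt xn addn0.
Qed.

Lemma count_geq x n : \sum_(c < n) (x <= c) = n - x.
Proof.
elim: n => [|n IH]; first by rewrite big_ord0.
by rewrite big_ord_recr /= IH; case: leqP => h; lia.
Qed.

Lemma sum_ord_add2 m : 2 * \sum_(i < m) (i + 2) = m * (m + 3).
Proof.
by elim: m => [|m IH]; rewrite ?big_ord0 // big_ord_recr /= mulnDr IH; lia.
Qed.

Lemma sum_ord_add2_sub m : 6 * \sum_(i < m) (i + 2) * (m - i) = m.+1 * m * (m + 5).
Proof.
elim: m => [|m IH]; first by rewrite big_ord0.
rewrite (eq_bigr (fun i : 'I_m.+1 => (i + 2) * (m - i) + (i + 2))); last first.
  by move=> i _; rewrite subSn -1?ltnS // mulnS addnC.
rewrite big_split /= big_ord_recr /= subnn muln0 addn0 mulnDr IH.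
have := sum_ord_add2 m.+1; move: (\sum_(i < m.+1) _) => x; nia.
Qed.

Lemma card_metric_indices m : 2 * (#|metric_indices m| + 1) = m.+1 * (m.+1 + 1).
Proof.
have -> : #|metric_indices m| + 1 = #|[set t : 'I_m.+1 * 'I_m.+1 | t.1 <= t.2]%SET|.
  rewrite (cardsD1 (ord0, ord0) [set t : 'I_m.+1 * 'I_m.+1 | t.1 <= t.2]%SET) inE /= addnC.
  by congr (_ + #|pred_of_set _|); apply/finset.setP => t; rewrite !inE andbC.
rewrite -sum1_card big_mkcond /=.
rewrite (eq_bigr (fun t : 'I_m.+1 * 'I_m.+1 => (t.1 <= t.2) : nat)); last first.
  by move=> t _; rewrite inE; case: (_ <= _).
rewrite -(pair_bigA _ (fun i j : 'I_m.+1 => (i <= j) : nat)) /=.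
under eq_bigr do rewrite count_geq.
elim: m => [|m IH]; first by rewrite big_ord_recl big_ord0.
by rewrite big_ord_recl mulnDr; under eq_bigr do rewrite subSS; rewrite IH /= subn0; nia.
Qed.

Lemma free_christoffelE m (a b c : 'I_m.+1) :
  ((a, b, c) \in free_christoffel m) =
  (b <= c) && (if b == ord0 then (c == ord0) || (a <= c) else a <= b).
Proof.
rewrite !inE /=; case: (leqP b c) => //= bc.
rewrite /dependent /spatial lower_id // upper_id // negb_and -leqNgt -leqNgt leqn0.
by case: (boolP (b == ord0)) => [_|b0] //; rewrite -[_ == 0]/(b == ord0) (negbTE b0).
Qed.

(** For b = 0, the value c = 0 leaves a arbitrary and c = i + 1 allows i + 2 values of a. For b = i
    + 1, there are i + 2 values a <= b and m - i values c >= b. *)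
Lemma card_free_christoffel m : 6 * (1 + #|free_christoffel m|) =
  m.+1 ^ 3 + 6 * m.+1 ^ 2 + 5 * m.+1.
Proof.
rewrite -sum1_card big_mkcond /=.
rewrite (eq_bigr (fun t : 'I_m.+1 * 'I_m.+1 * 'I_m.+1 =>
  (t.1.2 <= t.2) * (if t.1.2 == ord0 then (t.2 == ord0) || (t.1.1 <= t.2)
                    else t.1.1 <= t.1.2))); last first.
  move=> [[a b] c] _; rewrite free_christoffelE /=.
  by case: (b <= c) => //=; case: ifP => // _; case: (_ <= _); case: (_ == _).
rewrite -(pair_bigA _ (fun (ab : 'I_m.+1 * 'I_m.+1) (c : 'I_m.+1) =>
  (ab.2 <= c) * (if ab.2 == ord0 then (c == ord0) || (ab.1 <= c) else ab.1 <= ab.2))) /=.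
rewrite -(pair_bigA _ (fun (a b : 'I_m.+1) => \sum_(c < m.+1)
  (b <= c) * (if b == ord0 then (c == ord0) || (a <= c) else a <= b))) /=.
rewrite exchange_big big_ord_recl /=.
have -> : \sum_(a < m.+1) \sum_(c < m.+1) true * ((c == ord0) || (a <= c)) =
    m.+1 + \sum_(i < m) (i + 2).
  rewrite exchange_big big_ord_recl /=; congr (_ + _).
    rewrite (eq_bigr (fun _ => 1)) ?sum1_card ?card_ord //.
  apply: eq_bigr => i _; rewrite addn2 -(@count_leq i.+1 m.+1) ?ltnS //.
  by apply: eq_bigr => a _; rewrite mul1n.
rewrite (eq_bigr (fun i : 'I_m => (i + 2) * (m - i))); last first.
  move=> i _; rewrite exchange_big /=.
  rewrite (eq_bigr (fun c : 'I_m.+1 => (i.+1 <= c) * i.+2)); last first.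
    by move=> c _; rewrite -big_distrr /= (@count_leq i.+1 m.+1) ?ltnS.
  by rewrite -big_distrl /= count_geq subSS mulnC addn2.
have := sum_ord_add2_sub m; have := sum_ord_add2 m.
move: (\sum_(i < m) _) (\sum_(i < m) _) => x y; nia.
Qed.

End Counting.

(** * Choice of the constants for given parameters *)

Section FormalSolvability.
Variables (R : realType) (m : nat).
Local Notation n := m.+1.
Local Notation I := 'I_n.
Local Notation series := (mindex n -> R).
Variables (F : series) (gm : I * I * I -> series) (H : I * I -> series).

Hypotheses (F0 : F (mzero n) = 0)
  (H0 : forall t, t \in metric_indices m -> H t (mzero n) = 0)
  (HF : geometric F) (HH : forall t, t \in metric_indices m -> geometric (H t))
  (Hgm : forall t, t \in free_christoffel m -> geometric (gm t)).

Lemma formal_solution_exists : exists v G, formal_solution F gm H v G /\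
  exists rho lam C : R, [/\ 0 < rho, 1 <= lam,
   forall i j al, `|v i j al| <= C * weight (ord0 : I) rho lam al &
   forall a b c al, `|G a b c al| <= C * weight (ord0 : I) rho lam al].
Proof.
pose eps : R := (16 * n%:R)^-1.
have n0 : 0 < 16 * n%:R :> R by rewrite mulr_gt0 ?ltr0n.
have eps0 : 0 < eps by rewrite invr_gt0.
(* The constants of the free symbols are fixed before rho, since C must not depend on lam and rho
   must not affect K0; the value 0 is taken off the free set. *)
have [K HK] : exists K : I * I * I -> R, forall t, 0 <= K t /\
    (t \in free_christoffel m -> exists s, geometric_bound (gm t) (K t) s).
  suff /choice[K HK] : forall t : I * I * I, exists k : R, 0 <= k /\
      (t \in free_christoffel m -> exists s, geometric_bound (gm t) k s) by exists K.
  move=> t.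
  case: (boolP (t \in free_christoffel m)) => [/Hgm[C [s B]]|_]; last by exists 0.
  by exists C; split=> [|_]; [case: B|exists s].
pose K0 := \sum_t K t.
have K00 : 0 <= K0 by apply: sumr_ge0 => t _; case: (HK t).
have KK0 t : K t <= K0.
  by rewrite /K0 (bigD1 t) //= lerDl; apply: sumr_ge0 => t' _; case: (HK t').
have nF : \forall rho \near +oo, forall lam, 1 <= lam -> forall al,
    `|F al| <= eps * Phi (ord0 : I) rho lam al.
  by have [C [s B]] := HF; exact: geometric_majorant_small B F0 eps0.
have nH : \forall rho \near +oo, forall t, t \in metric_indices m ->
    forall lam, 1 <= lam -> forall al, `|H t al| <= eps * Phi (ord0 : I) rho lam al.
  apply: filter_forall => t; case: (boolP (t \in metric_indices m)) => tM.
    have [C [s B]] := HH tM.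
    by apply: filterS (geometric_majorant_small (ord0 : I) B (H0 tM) eps0) => rho h _.
  exact: nearW.
have nG : \forall rho \near +oo, forall t, t \in free_christoffel m ->
    forall lam, 1 <= lam -> forall al, `|gm t al| <= K t * Phi (ord0 : I) rho lam al.
  apply: filter_forall => t; case: (boolP (t \in free_christoffel m)) => tM.
    have [_ /(_ tM)[s B]] := HK t.
    by apply: filterS (geometric_majorant (ord0 : I) B) => rho h _.
  exact: nearW.
have np : \forall rho \near +oo, 0 < rho :> R by apply: nbhs_pinfty_gt; rewrite num_real.
have [rho [[rho0 hF] [hH hG]]] := filter_ex (filterI (filterI np nF) (filterI nH nG)).
pose C := 2 * (K0 + 2 * eps * rho).
have C0 : 0 <= C by rewrite mulr_ge0 // addr_ge0 // !mulr_ge0 // ltW.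
have er0 : 0 < eps * rho by rewrite mulr_gt0.
(* lam comes last because C depends on rho. The bounds on the data hold for all lam >= 1 at once, so
   they survive this choice. *)
pose lam := 1 + 4 * (eps * rho + 4 * C) / (eps * rho).
have lam1 : 1 <= lam.
  by rewrite lerDl divr_ge0 ?(ltW er0) // mulr_ge0 // addr_ge0 ?(ltW er0) // mulr_ge0.
have lamC : 4 * (eps * rho + 4 * C) <= eps * (lam * rho).
  have -> : eps * (lam * rho) = eps * rho + 4 * (eps * rho + 4 * C).
    by rewrite /lam; field; rewrite !gt_eqF.
  by rewrite lerDr ltW.
have epsn : 16 * n%:R * eps <= 1 by rewrite /eps divff // gt_eqF.
have hgm t : t \in free_christoffel m -> forall al,
    `|gm t al| <= K0 * Psi (ord0 : I) rho lam al.
  move=> tM al; apply: (le_trans (hG _ tM _ lam1 al)).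
  apply: ler_pM => //; first by case: (HK t).
    exact: ltW (Phi_gt0 _ rho0 lam1 _).
  exact: Phi_le_Psi.
have [b1 b2] := limit_bound rho0 lam1 eps0 K00 epsn lamC (hF _ lam1)
  (fun t tM => hH t tM _ lam1) hgm.
exists (limit_metric F gm H), (limit_christoffel F gm H); split.
  exact: fixpoint_solution (limit_fixpoint F gm H).
have w0 al : 0 <= weight (ord0 : I) rho lam al by apply: ltW; exact: weight_gt0.
exists rho, lam, (eps + C); split=> // [i j al|a b c al].
  apply: (le_trans (b1 i j al)).
  apply: (@le_trans _ _ (eps * weight (ord0 : I) rho lam al)).
    apply: ler_wpM2l; first exact: ltW.
    by apply: le_trans (Phi_le_Psi _ rho0 lam1 al) _; exact: Psi_le_weight.
  by apply: ler_wpM2r => //; rewrite lerDl.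
apply: (le_trans (b2 a b c al)).
apply: (@le_trans _ _ (C * weight (ord0 : I) rho lam al)).
  by apply: ler_wpM2l => //; exact: Psi_le_weight.
by apply: ler_wpM2r => //; rewrite lerDr ltW.
Qed.

Lemma formal_solution_unique v G v' G' : formal_solution F gm H v G ->
  formal_solution F gm H v' G' -> v = v' /\ G = G'.
Proof.
by move=> s s'; apply: (@fixpoint_unique _ _ F gm H); exact: solution_fixpoint.
Qed.

End FormalSolvability.

(** * Statistical structures and the formal system *)

(** With S the sum of the w_i^2, the estimate |w_i w_j| <= (w_i^2 + w_j^2)/2 bounds the deviation
    from S by e n S = S/2. *)
Lemma pos_def_near_identity (R : realType) n (A : 'I_n -> 'I_n -> R) (w : 'rV[R]_n) :
  (forall i j, `|A i j - (i == j)%:R| <= (2 * n%:R)^-1) -> w != 0 ->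
  0 < \sum_(i < n) \sum_(j < n) A i j * w 0 i * w 0 j.
Proof.
move=> hA w0; set e := (2 * n%:R)^-1 in hA.
have n0 : (0 < n)%N.
  by case: n w w0 {A hA e} => // w /eqP[]; apply/rowP => -[].
have nR : 0 < n%:R :> R by rewrite ltr0n.
pose S := \sum_(i < n) w 0 i ^+ 2.
have S0 : 0 < S.
  rewrite lt_neqAle sumr_ge0 ?andbT; last by move=> i _; exact: sqr_ge0.
  rewrite eq_sym psumr_neq0; last by move=> i _; exact: sqr_ge0.
  apply: contraT => /hasPn h; case/eqP: w0; apply/rowP => i; rewrite mxE.
  have := h i (mem_index_enum i); rewrite -leNgt => hi.
  by apply/eqP; rewrite -sqrf_eq0 eq_le hi sqr_ge0.
apply: (@lt_le_trans _ _ (S - e * (n%:R * S))).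
  have -> : e * (n%:R * S) = S / 2.
    by rewrite /e; move: nR; move: (n%:R : R) => N N0; field; rewrite gt_eqF.
  by lra.
have -> : S - e * (n%:R * S) = \sum_(i < n) \sum_(j < n)
   ((i == j)%:R * w 0 i * w 0 j - e * ((w 0 i ^+ 2 + w 0 j ^+ 2) / 2)).
  under [RHS]eq_bigr do rewrite sumrB -big_distrr -big_distrl big_split /= sumr_const card_ord.
  rewrite sumrB -big_distrr -big_distrl big_split /= sumr_const card_ord sumrMnl -/S.
  congr (_ - _); last first.
    by congr (_ * _); rewrite -[S *+ n]mulr_natl; move: (n%:R * S) => z; lra.
  apply: eq_bigr => i _; rewrite (bigD1 i) //= eqxx mul1r big1 ?addr0 ?expr2 //.
  by move=> j ji; rewrite eq_sym (negbTE ji) !mul0r.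
apply: ler_sum => i _; apply: ler_sum => j _.
have := hA i j; rewrite ler_norml => /andP[h1 h2].
have e0 : 0 <= e by rewrite invr_ge0 mulr_ge0.
move: (A i j) (w 0 i) (w 0 j) ((i == j)%:R : R) h1 h2 => a x y d h1 h2.
have hxy : 0 <= x ^+ 2 + y ^+ 2 - 2 * x * y by have := sqr_ge0 (x - y); lra.
have hxy' : 0 <= x ^+ 2 + y ^+ 2 + 2 * x * y by have := sqr_ge0 (x + y); lra.
have p1 : 0 <= e + (a - d) by lra.
have p2 : 0 <= e - (a - d) by lra.
have := mulr_ge0 p1 hxy'; have := mulr_ge0 p2 hxy; lra.
Qed.

Section Structures.
Variables (R : realType) (m : nat).
Local Notation n := m.+1.
Local Notation I := 'I_n.
Local Notation V := ('rV[R]_n).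
Local Notation series := (mindex n -> R).
Implicit Types (g : metric_coefs R n) (G : christoffel_symbols R n) (x : V).
Implicit Types (v : I -> I -> series) (Gs : I -> I -> I -> series).

Definition cst_series d (c : R) (al : mindex d) : R := if al == mzero d then c else 0.

Definition metric_series v i j : series :=
  fun al => cst_series (i == j)%:R al + v i j al.

Definition has_expansion g G v Gs : Prop :=
  (forall i j, has_ps (metric_series v i j) (g i j) 0) /\
  (forall k i j, has_ps (Gs k i j) (G k i j) 0).

Lemma pderiv_metric_series v k i j : pderiv k (metric_series v i j) =1 pderiv k (v i j).
Proof.
move=> al; rewrite /pderiv /metric_series /cst_series.
case: eqP => [/(congr1 (@mdegree n))|_]; last by rewrite add0r.
by rewrite mdegreeD mdegree_unit mdegree0.
Qed.

Definition defect g G k i j x : R :=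
  partial k (g i j) x - partial i (g k j) x - \sum_(l < n) G l k j x * g i l x
  + \sum_(l < n) G l i j x * g k l x.

(** Without torsion the terms Gamma^l_ki g_lj cancel. Total symmetry of the cubic form thus amounts
    to the vanishing of [defect], invariance in the last two arguments following from the symmetry
    of g. *)
Lemma cubic_formB g G k i j x : (forall k i j, torsion G k i j x = 0) ->
  cubic_form g G k i j x - cubic_form g G i k j x = defect g G k i j x.
Proof.
move=> tG; rewrite /cubic_form /defect.
have -> : \sum_(l < n) G l k i x * g l j x = \sum_(l < n) G l i k x * g l j x.
  by apply: eq_bigr => l _; have /eqP := tG l k i; rewrite /torsion subr_eq0 => /eqP ->.
ring.
Qed.

(** Writing g_il as delta_il plus a function vanishing at 0 isolates Gamma^i_kj and leaves products
    for which [mconv0] is the full Cauchy product. *)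
Lemma has_ps_lowered g G v Gs i k j : (forall i j, v i j (mzero n) = 0) ->
  has_expansion g G v Gs ->
  has_ps (lowered v Gs i k j) (fun x => \sum_(l < n) G l k j x * g i l x) 0.
Proof.
move=> v0 [hv hG].
have hu l : has_ps (v i l) (fun x => g i l x - (i == l)%:R) 0.
  have := has_psB (hv i l) (has_ps_cst (n := n) (i == l)%:R 0).
  apply: eq_has_ps => al.
  by rewrite /metric_series /cst_series addrAC subrr add0r.
have hq : has_ps (quad v Gs i k j)
    (fun x => \sum_(l < n) (g i l x - (i == l)%:R) * G l k j x) 0.
  apply: has_ps_sum => l; apply: eq_has_ps (has_psM (hu l) (hG l k j)).
  by apply: mconv_mconv0.
have := has_psD (hG i k j) hq; congr (has_ps _ _ _); apply/funext => x.
rewrite (eq_bigr (fun l => G l k j x * g i l x - (i == l)%:R * G l k j x)); last first.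
  by move=> l _; ring.
rewrite sumrB (bigD1 i) //= [X in _ + (_ - X)](bigD1 i) //= eqxx mul1r.
rewrite [X in _ + (_ - (_ + X))]big1; first by ring.
by move=> l /negbTE li; rewrite eq_sym li mul0r.
Qed.

Lemma has_ps_defect g G v Gs k i j : (forall i j, v i j (mzero n) = 0) ->
  has_expansion g G v Gs ->
  has_ps (codazzi_defect v Gs k i j) (defect g G k i j) 0.
Proof.
move=> v0 hgG; have [hv _] := hgG.
have h1 := eq_has_ps (pderiv_metric_series v k i j) (has_ps_partial k (hv i j)).
have h2 := eq_has_ps (pderiv_metric_series v i k j) (has_ps_partial i (hv k j)).
have h3 := has_ps_lowered i k j v0 hgG; have h4 := has_ps_lowered k i j v0 hgG.
exact: has_psD (has_psB (has_psB h1 h2) h3) h4.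
Qed.

Variables (f : V -> R) (gam : I * I * I -> V -> R) (h : I * I -> 'rV[R]_m -> R).
Variables (F : series) (gm : I * I * I -> series) (H : I * I -> series).

Hypotheses
  (F0 : F (mzero n) = 0)
  (H0 : forall t, t \in metric_indices m -> H t (mzero n) = 0)
  (fF : has_ps (fun al => cst_series 1 al + F al) f 0)
  (gamgm : forall t, t \in free_christoffel m -> has_ps (gm t) (gam t) 0)
  (hH : forall t, t \in metric_indices m ->
     has_ps (fun be => cst_series (t.1 == t.2)%:R be + H t (mcons0 be)) (h t) 0).

Lemma mcons0_eq0 (be : mindex m) : (mcons0 be == mzero n) = (be == mzero m).
Proof. by rewrite -!mdegree_eq0 mdegree_mcons0. Qed.

Lemma has_ps_metric_hyperplane g G v Gs i j : has_expansion g G v Gs ->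
  has_ps (fun be => cst_series (i == j)%:R be + v i j (mcons0 be))
         (fun y => g i j (hyperplane y)) 0.
Proof.
move=> [hv _]; apply: eq_has_ps (has_ps_hyperplane (hv i j)) => be.
by rewrite /= /metric_series /cst_series mcons0_eq0.
Qed.

Lemma formal_solution0 v Gs : formal_solution F gm H v Gs ->
  forall i j, v i j (mzero n) = 0.
Proof. move=> /solution_fixpoint s; exact: fixpoint_metric0 s. Qed.

(** Each condition on germs becomes an identity of series by uniqueness of expansions at 0. *)
Lemma structure_formal g G v Gs : has_expansion g G v Gs ->
  analytic_statistical_structure g G -> normalized g ->
  has_parameters (free_christoffel m) f gam h g G -> formal_solution F gm H v Gs.
Proof.
move=> hgG [_ _ posg torG codG] normg [pf pgam ph]; have [hv hG] := hgG.
have v0 i j : v i j (mzero n) = 0.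
  have [r Er] := hv i j; have := expands_monomial0 Er.
  by rewrite normg /metric_series /cst_series eqxx => /esym/eqP; rewrite -subr_eq0 addrC addKr => /eqP.
split.
- move=> i j; apply/funext => al.
  have : eq_germ (g i j) (g j i) by apply: filterS posg => x [].
  move=> /(has_ps_uniq (hv i j) (hv j i)) /(_ al).
  by rewrite /metric_series [i == j]eq_sym => /addrI.
- move=> k i j; apply/funext; apply: has_ps_uniq (hG k i j) (hG k j i) _.
  by apply: filterS torG => x /(_ k i j) /eqP; rewrite subr_eq0 => /eqP.
- apply/funext => al; have := has_ps_uniq (hv ord0 ord0) fF pf al.
  by rewrite /metric_series eqxx => /addrI.
- move=> t tM al /mcons0_surj[be <-].
  have := has_ps_uniq (has_ps_metric_hyperplane t.1 t.2 hgG) (hH tM) (ph t tM) be.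
  exact: addrI.
- by move=> t tS; apply/funext; apply: has_ps_uniq (hG _ _ _) (gamgm tS) (pgam t tS).
- move=> k i j al; apply: (has_ps_eq0 (has_ps_defect k i j v0 hgG)).
  apply: filterS2 torG codG => x tx /(_ k i j)[E _].
  by rewrite -cubic_formB // E subrr.
Qed.

Lemma formal_structure v Gs g G : formal_solution F gm H v Gs ->
  has_expansion g G v Gs -> (forall i j, g i j = g j i) ->
  (forall k i j, G k i j = G k j i) ->
  [/\ analytic_statistical_structure g G, normalized g &
      has_parameters (free_christoffel m) f gam h g G].
Proof.
move=> s hgG symg symG; have [hv hG] := hgG; have v0 := formal_solution0 s.
have [_ _ vF vinit Gfree cod] := s.
have c0 i j : metric_series v i j (mzero n) = (i == j)%:R.
  by rewrite /metric_series /cst_series eqxx v0 addr0.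
have tG x : forall k i j, torsion G k i j x = 0.
  by move=> k i j; rewrite /torsion symG subrr.
split.
- split.
  + by move=> i j; apply/analytic_around0P; exists (metric_series v i j).
  + by move=> k i j; apply/analytic_around0P; exists (Gs k i j).
  + pose e : R := (2 * n%:R)^-1.
    have n0 : 0 < n%:R :> R by rewrite ltr0n.
    have e0 : 0 < e by rewrite invr_gt0 mulr_gt0.
    have near_delta i j : \forall x \near (0 : V), `|g i j x - (i == j)%:R| <= e.
      by rewrite -c0; exact: has_ps_small.
    have := filter_forall (nbhs_filter _) (fun i => filter_forall (nbhs_filter _) (near_delta i)).
    apply: filterS => x hx; split=> [i j|w w0]; first by rewrite symg.
    exact: pos_def_near_identity hx w0.
  + by near=> x; exact: tG.
  + have near_defect k i j : \forall x \near (0 : V), defect g G k i j x = 0.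
      apply: (has_ps_germ (g := fun=> 0) (has_ps_defect k i j v0 hgG)).
      apply: eq_has_ps (has_ps_cst (n := n) 0 0) => al.
      by rewrite cod if_same.
    have := filter_forall (nbhs_filter _) (fun k => filter_forall (nbhs_filter _) (fun i => filter_forall (nbhs_filter _) (near_defect k i))).
    apply: filterS => x hx a b c; split.
      by apply/eqP; rewrite -subr_eq0 cubic_formB // hx.
    rewrite /cubic_form symg addrAC; congr (_ - _ - _).
      by apply: eq_bigr => l _; rewrite symg.
    by apply: eq_bigr => l _; rewrite symg.
- by move=> i j; have [r Er] := hv i j; rewrite (expands_monomial0 Er) c0.
- split.
  + apply: has_ps_germ fF; apply: eq_has_ps (hv ord0 ord0) => al.
    by rewrite /metric_series vF eqxx.
  + move=> t tS; apply: has_ps_germ (gamgm tS); rewrite -(Gfree t tS); exact: hG.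
  + move=> t tM; apply: has_ps_germ (hH tM).
    apply: eq_has_ps (has_ps_metric_hyperplane t.1 t.2 hgG) => be.
    by rewrite (vinit _ tM) ?mcons0_ord0.
Unshelve. all: by end_near. Qed.

End Structures.

(** * From parameters to structures and back *)

Section Extension.
Variables (R : realType) (m : nat).

(* The series of a function of [x^2, ..., x^n], seen as a function of [x^1, ..., x^n]. *)
Definition extended_series (b : mindex m -> R) (al : mindex m.+1) : R :=
  if al ord0 == 0%N then b [ffun j => al (lift ord0 j)] else 0.

Lemma extended_series_mcons0 b (be : mindex m) : extended_series b (mcons0 be) = b be.
Proof.
rewrite /extended_series mcons0_ord0 eqxx; congr b; apply/ffunP => j.
by rewrite ffunE mcons0_lift.
Qed.

Lemma geometric_extended_series b :
  geometric b -> geometric (extended_series b).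
Proof.
move=> [C [s [C0 s0 hb]]]; exists C, s; split=> // al.
case: (eqVneq (al ord0) 0%N) => [/mcons0_surj[be <-]|al0].
  by rewrite extended_series_mcons0 mdegree_mcons0.
by rewrite /extended_series (negbTE al0) normr0 mulr_ge0 ?exprn_ge0 ?(ltW s0).
Qed.

Lemma hyperplane0 : hyperplane (0 : 'rV[R]_m) = 0.
Proof.
apply/rowP => i; rewrite [RHS]mxE; case: (unliftP ord0 i) => [j|] ->.
  by rewrite hyperplane_lift mxE.
exact: hyperplane_ord0.
Qed.

End Extension.

Lemma series_choice (R : realType) n (T : finType) (A : {set T})
    (f : T -> 'rV[R]_n -> R) : (forall t, t \in A -> analytic_around0 (f t)) ->
  exists a, forall t, t \in A -> has_ps (a t) (f t) 0.
Proof.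
move=> hf; suff /choice[a ha] : forall t, exists a, t \in A -> has_ps a (f t) 0.
  by exists a.
move=> t; case: (boolP (t \in A)) => [/hf/analytic_around0P[a ha]|_].
  by exists a.
by exists (fun=> 0).
Qed.

Lemma structure_exists_unique (R : realType) (m : nat)
    (f : 'rV[R]_m.+1 -> R) (gam : 'I_m.+1 * 'I_m.+1 * 'I_m.+1 -> 'rV[R]_m.+1 -> R)
    (h : 'I_m.+1 * 'I_m.+1 -> 'rV[R]_m -> R) :
  admissible_parameters (free_christoffel m) f gam h ->
  exists (g : metric_coefs R m.+1) (G : christoffel_symbols R m.+1),
    [/\ analytic_statistical_structure g G, normalized g,
        has_parameters (free_christoffel m) f gam h g G &
        forall g' G', analytic_statistical_structure g' G' -> normalized g' ->
          has_parameters (free_christoffel m) f gam h g' G' ->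
          eq_structure_germ g G g' G'].
Proof.
move=> [[/analytic_around0P[af haf] f0] /series_choice[gm hgm] hh].
have [ah hah] := series_choice (fun t tM => (hh t tM).1).
pose F al := af al - cst_series 1 al.
(* The initial data are extended as functions constant in x^1, after subtraction of their values at
   0. *)
pose d t be := ah t be - cst_series (t.1 == t.2)%:R be.
pose H t := extended_series (d t).
have psF : has_ps F (fun x => f x - 1) 0 := has_psB haf (has_ps_cst 1 0).
have psd t : t \in metric_indices m ->
    has_ps (d t) (fun y => h t y - (t.1 == t.2)%:R) 0.
  by move=> tM; exact: has_psB (hah t tM) (has_ps_cst _ 0).
have F0 : F (mzero m.+1) = 0.
  by have [r Er] := psF; rewrite -(expands_monomial0 Er) f0 subrr.
have m0 : mcons0 (mzero m) = mzero m.+1 by apply/eqP; rewrite mcons0_eq0.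
have H0 t : t \in metric_indices m -> H t (mzero m.+1) = 0.
  move=> tM; rewrite /H -m0 extended_series_mcons0; have [r Er] := psd t tM.
  by rewrite -(expands_monomial0 Er) (hh t tM).2 subrr.
have fF : has_ps (fun al => cst_series 1 al + F al) f 0.
  by apply: eq_has_ps haf => al; rewrite /F addrC subrK.
have hH t : t \in metric_indices m ->
    has_ps (fun be => cst_series (t.1 == t.2)%:R be + H t (mcons0 be)) (h t) 0.
  move=> tM; apply: eq_has_ps (hah t tM) => be.
  by rewrite /H extended_series_mcons0 /d addrC subrK.
have gF : geometric F := has_ps_geometric psF.
have gH t : t \in metric_indices m -> geometric (H t).
  by move=> tM; apply: geometric_extended_series; exact: has_ps_geometric (psd t tM).
have gG t : t \in free_christoffel m -> geometric (gm t).
  by move=> tS; exact: has_ps_geometric (hgm t tS).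
have [v [Gs [sol [rho [lam [C [rho0 lam1 bv bG]]]]]]] := formal_solution_exists F0 H0 gF gH gG.
pose g i j := psum (metric_series v i j).
pose G k i j := psum (Gs k i j).
have ps (a : mindex m.+1 -> R) :
    (forall al, `|a al| <= C * weight (ord0 : 'I_m.+1) rho lam al) -> has_ps a (psum a) 0.
  by move=> /(abs_bounded_weight rho0 lam1)[r r0 ba]; exact: has_ps_psum ba.
have hgG : has_expansion g G v Gs.
  split=> [i j|k i j]; last exact: ps.
  (* Adding the constant serves only to obtain a radius at which [metric_series v i j] is absolutely
     bounded; [psum] then takes its sum. *)
  have := has_psD (has_ps_cst (i == j)%:R 0) (ps _ (bv i j)).
  move=> [r [r0 ba _]]; exact: has_ps_psum ba.
have [sv sG _ _ _ _] := sol.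
have symg i j : g i j = g j i by rewrite /g /metric_series sv eq_sym.
have symG k i j : G k i j = G k j i by rewrite /G sG.
have [st nm pr] := formal_structure F0 H0 fF hgm hH sol hgG symg symG.
exists g, G; split=> // g' G' st' nm' pr'.
(* Any competitor is expanded at 0 as well: it solves the same formal system, hence has the same
   series. *)
have [v' hv'] : exists v', forall i j, has_ps (metric_series v' i j) (g' i j) 0.
  have /choice[a ha] : forall t : 'I_m.+1 * 'I_m.+1, exists a, has_ps a (g' t.1 t.2) 0.
    by move=> t; apply/analytic_around0P; exact: metric_analytic st' _ _.
  exists (fun i j al => a (i, j) al - cst_series (i == j)%:R al) => i j.
  by apply: eq_has_ps (ha (i, j)) => al; rewrite /metric_series addrC subrK.
have [Gs' hGs'] : exists Gs', forall k i j, has_ps (Gs' k i j) (G' k i j) 0.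
  have /choice[a ha] : forall t : 'I_m.+1 * 'I_m.+1 * 'I_m.+1,
      exists a, has_ps a (G' t.1.1 t.1.2 t.2) 0.
    by move=> t; apply/analytic_around0P; exact: connection_analytic st' _ _ _.
  by exists (fun k i j => a (k, i, j)) => k i j; exact: (ha (k, i, j)).
have sol' := structure_formal fF hgm hH (conj hv' hGs') st' nm' pr'.
have [E1 E2] := formal_solution_unique sol sol'; subst v' Gs'.
split=> [i j|k i j]; first exact: has_ps_germ (hgG.1 i j) (hv' i j).
exact: has_ps_germ (hgG.2 k i j) (hGs' k i j).
Qed.

Lemma parameters_exist (R : realType) (m : nat) (g : metric_coefs R m.+1)
    (G : christoffel_symbols R m.+1) :
  analytic_statistical_structure g G -> normalized g ->
  exists f gam h, admissible_parameters (free_christoffel m) f gam h /\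
    has_parameters (free_christoffel m) f gam h g G.
Proof.
move=> st nm.
exists (g ord0 ord0), (fun t => G t.1.1 t.1.2 t.2), (fun t y => g t.1 t.2 (hyperplane y)).
have refl d (k : 'rV[R]_d -> R) : eq_germ k k by near=> x.
split; last by split=> *; exact: refl.
split=> [|t _|t _].
- by split; [exact: metric_analytic st _ _|rewrite nm eqxx].
- exact: connection_analytic st _ _ _.
- split; last by rewrite hyperplane0 nm.
  have /analytic_around0P[a ha] := metric_analytic st t.1 t.2.
  by apply/analytic_around0P; exists (a \o @mcons0 m); exact: has_ps_hyperplane.
Unshelve. all: by end_near. Qed.

Theorem theorem4p2 (R : realType) (m : nat) (hn : (2 < m.+1)%N) :
  let n := m.+1 in
  exists S : {set 'I_n * 'I_n * 'I_n},
    [/\ (* S selects (n^3 + 6 n^2 + 5 n - 6) / 6 Christoffel symbols; together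
           with g_11 they are (n^3 + 6 n^2 + 5 n) / 6 functions of n variables *)
        S \subset christoffel_indices m /\
        (6 * #|S| = n ^ 3 + 6 * n ^ 2 + 5 * n - 6)%N /\
        (6 * (1 + #|S|) = n ^ 3 + 6 * n ^ 2 + 5 * n)%N,
        (* n (n + 1) / 2 - 1 functions of n - 1 variables *)
        (2 * (#|metric_indices m| + 1) = n * (n + 1))%N,
        (* the parameters may be chosen arbitrarily and determine the germ of
           the structure *)
        forall (f : 'rV[R]_n -> R) (gam : 'I_n * 'I_n * 'I_n -> 'rV[R]_n -> R)
               (h : 'I_n * 'I_n -> 'rV[R]_m -> R),
          admissible_parameters S f gam h ->
          exists (g : metric_coefs R n) (G : christoffel_symbols R n),
            [/\ analytic_statistical_structure g G,
                normalized g,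
                has_parameters S f gam h g G &
                forall (g' : metric_coefs R n) (G' : christoffel_symbols R n),
                  analytic_statistical_structure g' G' ->
                  normalized g' ->
                  has_parameters S f gam h g' G' ->
                  eq_structure_germ g G g' G'] &
        (* every structure is obtained in this way *)
        forall (g : metric_coefs R n) (G : christoffel_symbols R n),
          analytic_statistical_structure g G ->
          normalized g ->
          exists (f : 'rV[R]_n -> R)
                 (gam : 'I_n * 'I_n * 'I_n -> 'rV[R]_n -> R)
                 (h : 'I_n * 'I_n -> 'rV[R]_m -> R),
            admissible_parameters S f gam h /\ has_parameters S f gam h g G].
Proof.
move=> n; exists (free_christoffel m).
have card6 := card_free_christoffel m.
split; [|exact: card_metric_indices|exact: structure_exists_unique|exact: parameters_exist].
split; last by split=> //; rewrite -card6 mulnDr addKn.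
by apply/fintype.subsetP => t; rewrite inE => /andP[].
Qed.
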